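(* Let $k$ be a field, let $H$ be a finite group acting by automorphisms on a discrete group $\Gamma$, let $R$ be a $k$-algebra and let $\rho:k[\Gamma]\rtimes k^H\to R$ be an algebra map such that $\rho_{|k^H}$ is inner faithful. Let $$\mathcal E(\rho)=\{(N,\Phi)\ |\ (H,N,\Phi)\in\mathrm{QD}(H\curvearrowright\Gamma)\text{ and } \rho(r\#1)=\rho(1\#\Phi(r))\ \ \forall r\in N\}.$$ (a) For any $(N,\Phi)\in\mathcal E(\rho)$ there is a factorization $\rho=\tilde\rho\, q$ with $q:k[\Gamma]\rtimes k^H\to k[\Gamma/N]\rtimes_\Phi k^H$ a surjective Hopf algebra map and $\tilde\rho:k[\Gamma/N]\rtimes_\Phi k^H\to R$ an algebra map, where, if $j:\Gamma/N\to\Gamma$ is a section of the canonical projection $u:\Gamma\to\Gamma/N$ with $ju(1)=1$ (and $k[\Gamma/N]\rtimes_\Phi k^H$ is formed using $j$), $q(r\#\delta_h)=u(r)\#\delta_h\Phi(r\,ju(r)^{-1})$ and $\tilde\rho(u(r)\#\delta_h)=\rho(ju(r)\#\delta_h)$. (b) Endow $\mathcal E(\rho)$ with the partial order $(N,\Phi)\le(M,\Psi)\iff N\subset M$ and $\Psi_{|N}=\Phi$. Then $\mathcal E(\rho)$ admits a maximal element. (c) For any maximal element $(N,\Phi)\in\mathcal E(\rho)$, the factorization in (a) is universal, and $k[\Gamma/N]\rtimes_\Phi k^H$ is isomorphic to the Hopf image of $\rho$.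
   Context: $k[\Gamma]$ is the group algebra and $k^H$ is the Hopf algebra of $k$-valued functions on $H$, with basis $(\delta_h)_{h\in H}$. The smash coproduct $k[\Gamma]\rtimes k^H$ is $k[\Gamma]\otimes k^H$ as an algebra (write $r\#\delta_h$ for $r\otimes\delta_h$), with $$\Delta(r\#\delta_h)=\sum_{l\in H} r\#\delta_l\otimes l^{-1}.r\#\delta_{l^{-1}h},\quad \varepsilon(r\#\delta_h)=\delta_{h,1},\quad S(r\#\delta_h)=h^{-1}.r^{-1}\#\delta_{h^{-1}}.$$ $k^H$ is viewed as the Hopf subalgebra $1\#k^H$. Quotient data: $\mathrm{QD}(H\curvearrowright\Gamma)$ is the set of triples $(G,N,\Phi)$ where $G\subset H$ is a subgroup, $N\triangleleft\Gamma$ is a normal and $G$-stable subgroup, and $\Phi:N\to (k^G)^\times$ is a group morphism with $\Phi(r)(lh)=\Phi(l^{-1}.r)(h)\,\Phi(r)(l)$ and $\Phi(r)=\Phi(srs^{-1})$ for all $r\in N$, $s\in\Gamma$, $h,l\in G$. The Hopf algebra $k[\Gamma/N]\rtimes_\Phi k^G$: let $u:\Gamma\to\Gamma/N$ be the canonical projection, and choose a section $j:\Gamma/N\to\Gamma$ of $u$ with $ju(1)=1$. As a vector space it is $k[\Gamma/N]\otimes k^G$ (write $u(r)\# f$ for $u(r)\otimes f$), with unit $u(1)\#1$, counit $\varepsilon(u(r)\#\delta_h)=\delta_{h,1}$, and $$(u(r)\#\delta_h)(u(s)\#\delta_{h'})=u(rs)\#\delta_h\delta_{h'}\Phi(ju(r)\,ju(s)\,ju(rs)^{-1}),$$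 $$\Delta(u(r)\#\delta_h)=\sum_{l\in G}(u(r)\#\delta_{l^{-1}})\otimes \big(u(l.r)\#\delta_{lh}\Phi(l.ju(r)\,ju(l.r)^{-1})\big),$$ $$S(u(r)\#\delta_h)=u(h^{-1}.r^{-1})\#\Phi\big(ju(h^{-1}.r^{-1})^{-1}\,h^{-1}.ju(r)^{-1}\big)\delta_{h^{-1}}.$$ Up to isomorphism it does not depend on $j$. Hopf images: for a Hopf algebra $A$, an algebra $R$ and an algebra map $\rho:A\to R$, a factorization of $\rho$ is a triple $(L,q,\varphi)$ with $L$ a Hopf algebra, $q:A\to L$ a surjective Hopf algebra map and $\varphi:L\to R$ an algebra map with $\rho=\varphi q$. The Hopf image of $\rho$ is the final (universal) factorization $(A_\rho,p,\tilde\rho)$: for any factorization $(L,q,\varphi)$ there is a unique Hopf algebra map $f:L\to A_\rho$ with $fq=p$ and $\tilde\rho f=\varphi$. It always exists. The map $\rho$ is inner faithful if $(A,\mathrm{id}_A,\rho)$ is its Hopf image, equivalently if $\mathrm{Ker}(\rho)$ contains no non-zero Hopf ideal. *)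

(* Defs.v *)
From HB Require Import structures.
From mathcomp Require Import all_boot all_order all_algebra fingroup.
From mathcomp Require Import boolp finmap monalg generic_quotient.

Set Implicit Arguments.
Unset Strict Implicit.
Unset Printing Implicit Defensive.

Import GRing.Theory.
Local Open Scope ring_scope.

Section LinearFacts.
Variable k : fieldType.
Implicit Types U V W : lmodType k.

Lemma linear_comp_fun U V W (f : V -> W) (g : U -> V) :
  linear f -> linear g -> linear (fun x => f (g x)).
Proof. by move=> hf hg a x y /=; rewrite hg hf. Qed.

Lemma linear0f U V (f : U -> V) : linear f -> f 0 = 0.
Proof.
move=> hf; have := hf 1 0 0; rewrite scale1r addr0 scale1r => /eqP.
by rewrite -subr_eq subrr => /eqP.
Qed.

Lemma linearZf U V (f : U -> V) a x : linear f -> f (a *: x) = a *: f x.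
Proof. by move=> hf; have := hf a x 0; rewrite !addr0 (linear0f hf) addr0. Qed.

Lemma linearDf U V (f : U -> V) x y : linear f -> f (x + y) = f x + f y.
Proof. by move=> hf; have := hf 1 x y; rewrite !scale1r. Qed.

Lemma linear_sumf U V (f : U -> V) I (s : seq I) (v : I -> U) : linear f ->
  f (\sum_(i <- s) v i) = \sum_(i <- s) f (v i).
Proof.
move=> hf; rewrite (big_morph f (id1 := 0) (op1 := +%R)) //.
  by move=> x y; apply: linearDf.
exact: linear0f.
Qed.

Lemma linear_sumZ U V (f : U -> V) I (s : seq I) (c : I -> k) (v : I -> U) :
  linear f -> f (\sum_(i <- s) c i *: v i) = \sum_(i <- s) c i *: f (v i).
Proof.
move=> hf; rewrite linear_sumf //; apply: eq_bigr => i _.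
by rewrite linearZf.
Qed.

End LinearFacts.

Definition bilinear_map (k : fieldType) (V W U : lmodType k)
    (f : V -> W -> U) : Prop :=
  (forall w, linear (f^~ w)) /\ (forall v, linear (f v)).

(* The tensor product: formal sums of pairs, two of them being identified when
   all bilinear maps agree on them. *)
Section Tensor.
Variables (k : fieldType).
Implicit Types (U V W : lmodType k).

Definition fsum V W U (f : V -> W -> U) (s : seq (V * W)) : U :=
  \sum_(p <- s) f p.1 p.2.

Definition tensor_rel V W : rel (seq (V * W)) := fun s t =>
  `[< forall U (f : V -> W -> U), bilinear_map f -> fsum f s = fsum f t >].

Fact tensor_rel_equiv V W : equiv_class_of (@tensor_rel V W).
Proof.
split=> [s|s t|t s u].
- exact/asboolP.
- by apply/asboolP/asboolP => h U f hf; rewrite h.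
- move=> /asboolP h1 /asboolP h2; apply/asboolP => U f hf.
  by rewrite h1 // h2.
Qed.

Canonical tensor_equiv V W := EquivRelPack (@tensor_rel_equiv V W).

Definition tensor V W := {eq_quot (tensor_equiv V W)}%qT.

HB.instance Definition _ V W := Choice.on (tensor V W).
HB.instance Definition _ V W := EqQuotient.on (tensor V W).

Definition tpure V W (v : V) (w : W) : tensor V W :=
  \pi_(tensor V W)%qT [:: (v, w)].

(* The linear map induced by [f], when [f] is bilinear. *)
Definition tlift V W U (f : V -> W -> U) (t : tensor V W) : U :=
  fsum f (repr t).

Definition tadd V W (s t : tensor V W) : tensor V W :=
  \pi_(tensor V W)%qT (repr s ++ repr t).
Definition tscale V W (a : k) (t : tensor V W) : tensor V W :=
  \pi_(tensor V W)%qT [seq (a *: p.1, p.2) | p <- repr t].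
Definition topp V W (t : tensor V W) : tensor V W := tscale (-1) t.
Definition tzero V W : tensor V W := \pi_(tensor V W)%qT [::].

Section TensorTheory.
Variables V W U : lmodType k.
Implicit Types (s t : tensor V W) (f : V -> W -> U).

Lemma fsum_cat f x y : fsum f (x ++ y) = fsum f x + fsum f y.
Proof. by rewrite /fsum big_cat. Qed.

Lemma fsum_scale f a x : bilinear_map f ->
  fsum f [seq (a *: p.1, p.2) | p <- x] = a *: fsum f x.
Proof.
move=> [hl _]; rewrite /fsum big_map scaler_sumr; apply: eq_bigr => p _ /=.
exact: (linearZf a p.1 (hl p.2)).
Qed.

Lemma tensor_eqP (x y : seq (V * W)) :
  reflect (forall U' (f : V -> W -> U'), bilinear_map f -> fsum f x = fsum f y)
          (\pi_(tensor V W)%qT x == \pi_(tensor V W)%qT y).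
Proof. by rewrite eqmodE; apply: asboolP. Qed.

Lemma tlift_pi f (x : seq (V * W)) : bilinear_map f ->
  tlift f (\pi_(tensor V W)%qT x) = fsum f x.
Proof.
move=> hf; have /eqP/tensor_eqP h := reprK (\pi_(tensor V W)%qT x).
by rewrite /tlift h.
Qed.

Lemma tlift_pure f v w : bilinear_map f -> tlift f (tpure v w) = f v w.
Proof. by move=> hf; rewrite tlift_pi // /fsum big_seq1. Qed.

End TensorTheory.

Section TensorLmod.
Variables V W : lmodType k.
Implicit Types (s t : tensor V W).

Lemma tensorP s t :
  (forall U (f : V -> W -> U), bilinear_map f -> tlift f s = tlift f t) -> s = t.
Proof.
move=> h; rewrite -[s]reprK -[t]reprK; apply/eqP/tensor_eqP => U f hf.
exact: h.
Qed.

Lemma tlift_add U (f : V -> W -> U) s t : bilinear_map f ->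
  tlift f (tadd s t) = tlift f s + tlift f t.
Proof. by move=> hf; rewrite tlift_pi // fsum_cat. Qed.

Lemma tlift_scale U (f : V -> W -> U) a t : bilinear_map f ->
  tlift f (tscale a t) = a *: tlift f t.
Proof. by move=> hf; rewrite tlift_pi // fsum_scale. Qed.

Lemma tlift_zero U (f : V -> W -> U) : bilinear_map f ->
  tlift f (tzero V W) = 0.
Proof. by move=> hf; rewrite tlift_pi // /fsum big_nil. Qed.

Fact taddA : associative (@tadd V W).
Proof. by move=> r s t; apply: tensorP => U f hf; rewrite !tlift_add // addrA. Qed.
Fact taddC : commutative (@tadd V W).
Proof. by move=> s t; apply: tensorP => U f hf; rewrite !tlift_add // addrC. Qed.
Fact tadd0 : left_id (tzero V W) (@tadd V W).
Proof.
by move=> t; apply: tensorP => U f hf; rewrite tlift_add // tlift_zero // add0r.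
Qed.
Fact taddN : left_inverse (tzero V W) (@topp V W) (@tadd V W).
Proof.
move=> t; apply: tensorP => U f hf.
by rewrite tlift_add // tlift_scale // tlift_zero // scaleN1r addNr.
Qed.

HB.instance Definition _ :=
  GRing.isZmodule.Build (tensor V W) taddA taddC tadd0 taddN.

Fact tscaleA a b t : tscale a (tscale b t) = tscale (a * b) t.
Proof. by apply: tensorP => U f hf; rewrite !tlift_scale // scalerA. Qed.
Fact tscale1 : left_id 1 (@tscale V W).
Proof. by move=> t; apply: tensorP => U f hf; rewrite tlift_scale // scale1r. Qed.
Fact tscaleDr : right_distributive (@tscale V W) +%R.
Proof.
move=> a s t; apply: tensorP => U f hf.
by rewrite tlift_scale // !tlift_add // !tlift_scale // scalerDr.
Qed.
Fact tscaleDl t : {morph (@tscale V W)^~ t : a b / a + b}.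
Proof.
move=> a b; apply: tensorP => U f hf.
by rewrite tlift_add // !tlift_scale // scalerDl.
Qed.

HB.instance Definition _ := GRing.Zmodule_isLmodule.Build k (tensor V W)
  tscaleA tscale1 tscaleDr tscaleDl.

Lemma tlift_linear U (f : V -> W -> U) : bilinear_map f -> linear (tlift f).
Proof.
by move=> hf a s t; rewrite [LHS]tlift_add // [X in X + _]tlift_scale.
Qed.

Lemma tpure_bilinear : bilinear_map (@tpure V W).
Proof.
split=> [w a v v'|v a w w']; apply: tensorP => U f [hl hr];
  by rewrite (tlift_linear (conj hl hr)) !tlift_pure //= ?hr //; apply: (hl w).
Qed.

Lemma tensor_span t : t = \sum_(p <- repr t) tpure p.1 p.2.
Proof.
apply: tensorP => U f hf.
have hz : tlift f 0 = 0 by exact: tlift_zero.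
have ha x y : tlift f (x + y) = tlift f x + tlift f y by exact: tlift_add.
rewrite (big_morph _ ha hz) [LHS]/tlift /fsum.
by apply: eq_bigr => p _; rewrite tlift_pure.
Qed.

(* Together with [tlift_pure] and [tlift_linear], this is the universal
   property of the tensor product. *)
Lemma tensor_ext U (g h : tensor V W -> U) : linear g -> linear h ->
  (forall v w, g (tpure v w) = h (tpure v w)) -> g =1 h.
Proof.
move=> hg hh e t; rewrite [t]tensor_span !linear_sumf //.
by apply: eq_bigr => p _; apply: e.
Qed.

End TensorLmod.
End Tensor.

Notation "x ⊗ y" := (tpure x y) (at level 38, left associativity) : ring_scope.

Section TensorMaps.
Variable k : fieldType.

Definition tmap (V W V' W' : lmodType k) (f : V -> V') (g : W -> W') :
    tensor V W -> tensor V' W' := tlift (fun v w => f v ⊗ g w).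

Definition tassoc (U V W : lmodType k) :
    tensor (tensor U V) W -> tensor U (tensor V W) :=
  tlift (fun t w => tlift (fun u v => u ⊗ (v ⊗ w)) t).

Definition tmul (A B : algType k) (s t : tensor A B) : tensor A B :=
  tlift (fun a b => tlift (fun a' b' => (a * a') ⊗ (b * b')) t) s.

End TensorMaps.

HB.mixin Record Algebra_isHopf (k : fieldType) A of GRing.Algebra k A := {
  comul : A -> tensor A A;
  counit : A -> k;
  antipode : A -> A;
  comul_linear : linear comul;
  counit_scalar : scalar counit;
  antipode_linear : linear antipode;
  comulA : forall a : A,
    tassoc (tmap comul idfun (comul a)) = tmap idfun comul (comul a);
  comul_counitl : forall a : A, tlift (fun x y => counit x *: y) (comul a) = a;
  comul_counitr : forall a : A, tlift (fun x y => counit y *: x) (comul a) = a;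
  comul1 : comul 1 = 1 ⊗ 1;
  comulM : forall a b : A, comul (a * b) = tmul (comul a) (comul b);
  counit1 : counit 1 = 1;
  counitM : {morph counit : a b / a * b};
  antipodel : forall a : A,
    tlift (fun x y => antipode x * y) (comul a) = (counit a)%:A;
  antipoder : forall a : A,
    tlift (fun x y => x * antipode y) (comul a) = (counit a)%:A
}.

#[short(type="hopfAlgType")]
HB.structure Definition HopfAlgebra (k : fieldType) :=
  { A of GRing.Algebra k A & Algebra_isHopf k A }.

Section HopfMaps.
Variables (k : fieldType).

Definition hopf_map (A B : hopfAlgType k) (f : {lrmorphism A -> B}) : Prop :=
  (forall a, comul (f a) = tmap f f (comul a)) /\
  (forall a, counit (f a) = counit a).

Definition hopf_factorization (A : hopfAlgType k) (R : algType k)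
    (rho : {lrmorphism A -> R}) (L : hopfAlgType k)
    (q : {lrmorphism A -> L}) (phi : {lrmorphism L -> R}) : Prop :=
  [/\ hopf_map q, (forall y, exists x, q x = y) & rho =1 phi \o q].

Definition hopf_image (A : hopfAlgType k) (R : algType k)
    (rho : {lrmorphism A -> R}) (L : hopfAlgType k)
    (q : {lrmorphism A -> L}) (phi : {lrmorphism L -> R}) : Prop :=
  hopf_factorization rho q phi /\
  forall (L' : hopfAlgType k) (q' : {lrmorphism A -> L'})
      (phi' : {lrmorphism L' -> R}), hopf_factorization rho q' phi' ->
    exists f : {lrmorphism L' -> L},
      [/\ hopf_map f, f \o q' =1 q & phi \o f =1 phi'] /\
      (forall g : {lrmorphism L' -> L},
         [/\ hopf_map g, g \o q' =1 q & phi \o g =1 phi'] -> g =1 f).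

Definition inner_faithful (A : hopfAlgType k) (R : algType k)
    (rho : {lrmorphism A -> R}) : Prop :=
  hopf_image rho (idfun : {lrmorphism A -> A}) rho.

Definition hopf_isomorphic (A B : hopfAlgType k) : Prop :=
  exists f : {lrmorphism A -> B}, hopf_map f /\ bijective f.

End HopfMaps.

(* A left action by group automorphisms ([act h] is inverse to [act h^-1]). *)
Record autAction (H : finGroupType) (Gam : groupType) := AutAction {
  aut_act :> H -> Gam -> Gam;
  aut_act1 : forall r, aut_act 1%g r = r;
  aut_actM : forall h l r, aut_act (h * l)%g r = aut_act h (aut_act l r);
  aut_actMr : forall h r s,
    aut_act h (r * s)%g = (aut_act h r * aut_act h s)%g
}.

Lemma aut_act1g (H : finGroupType) (Gam : groupType) (act : autAction H Gam) h :
  act h 1%g = 1%g.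
Proof. by apply: (@mulgI _ (act h 1%g)); rewrite -aut_actMr !mulg1. Qed.

Lemma aut_actV (H : finGroupType) (Gam : groupType) (act : autAction H Gam) h r :
  act h (r^-1)%g = ((act h r)^-1)%g.
Proof.
by apply: (@mulgI _ (act h r)); rewrite mulgV -aut_actMr mulgV aut_act1g.
Qed.

Record normalSubgroup (Gam : groupType) := NormalSubgroup {
  nsg_pred :> {pred Gam};
  nsg_closed : group_closed nsg_pred;
  nsg_normal : forall r s, r \in nsg_pred -> (s * r * s^-1)%g \in nsg_pred
}.

Section NormalSubgroupTheory.
Variables (Gam : groupType) (N : normalSubgroup Gam).

Lemma nsg1 : 1%g \in N. Proof. by have [] := nsg_closed N. Qed.
Lemma nsgF r s : r \in N -> s \in N -> (r / s)%g \in N.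
Proof. by have [_] := nsg_closed N; apply. Qed.
Lemma nsgV r : r \in N -> (r^-1)%g \in N.
Proof. by move=> hr; rewrite -[(r^-1)%g]mul1g; apply: nsgF => //; apply: nsg1. Qed.
Lemma nsgM r s : r \in N -> s \in N -> (r * s)%g \in N.
Proof. by move=> hr hs; rewrite -[s]invgK; apply: nsgF => //; apply: nsgV. Qed.

Definition coset_rel : rel Gam := fun r s => (r * s^-1)%g \in N.

Fact coset_rel_equiv : equiv_class_of coset_rel.
Proof.
rewrite /coset_rel; split=> [r|r s|r s t h1 h2].
- by rewrite mulgV nsg1.
- by apply/idP/idP => /nsgV; rewrite invgM invgK.
- by have := nsgM h1 h2; rewrite mulgA mulgVK.
Qed.

Canonical coset_equiv := EquivRelPack coset_rel_equiv.

Definition quotGroup := {eq_quot coset_equiv}%qT.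

HB.instance Definition _ := Choice.on quotGroup.
HB.instance Definition _ := EqQuotient.on quotGroup.

Definition canproj (r : Gam) : quotGroup := \pi_quotGroup%qT r.

Lemma canproj_eq r s : (canproj r == canproj s) = ((r * s^-1)%g \in N).
Proof. exact: eqmodE. Qed.

Lemma canproj_repr (x : quotGroup) : canproj (repr x) = x.
Proof. exact: reprK. Qed.

Definition quot_one : quotGroup := canproj 1.
Definition quot_inv (x : quotGroup) : quotGroup := canproj (repr x)^-1.
Definition quot_mul (x y : quotGroup) : quotGroup := canproj (repr x * repr y).

Lemma canproj_mul r s : quot_mul (canproj r) (canproj s) = canproj (r * s).
Proof.
apply/eqP; rewrite canproj_eq.
have /eqP := canproj_repr (canproj r); rewrite canproj_eq => h1.
have /eqP := canproj_repr (canproj s); rewrite canproj_eq => h2.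
set a := repr _ in h1 *; set b := repr _ in h2 *.
have := nsgM (nsg_normal a h2) h1.
by rewrite invgM !mulgA mulgVK.
Qed.

Lemma canproj_inv r : quot_inv (canproj r) = canproj (r^-1).
Proof.
apply/eqP; rewrite canproj_eq invgK.
have /eqP := canproj_repr (canproj r); rewrite canproj_eq => h1.
set a := repr _ in h1 *.
have := nsg_normal a^-1 (nsgV h1).
by rewrite invgK invgM invgK !mulgA mulgVK.
Qed.

Fact quot_mulA : associative quot_mul.
Proof.
move=> x y z; rewrite -(canproj_repr x) -(canproj_repr y) -(canproj_repr z).
by rewrite !canproj_mul mulgA.
Qed.
Fact quot_mul1 : left_id quot_one quot_mul.
Proof. by move=> x; rewrite -(canproj_repr x) canproj_mul mul1g. Qed.
Fact quot_1mul : right_id quot_one quot_mul.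
Proof. by move=> x; rewrite -(canproj_repr x) canproj_mul mulg1. Qed.
Fact quot_mulV : left_inverse quot_one quot_inv quot_mul.
Proof.
by move=> x; rewrite -(canproj_repr x) canproj_inv canproj_mul mulVg.
Qed.
Fact quot_Vmul : right_inverse quot_one quot_inv quot_mul.
Proof.
by move=> x; rewrite -(canproj_repr x) canproj_inv canproj_mul mulgV.
Qed.

HB.instance Definition _ := isGroup.Build quotGroup
  quot_mulA quot_mul1 quot_1mul quot_mulV quot_Vmul.

Lemma canprojM r s : canproj (r * s)%g = (canproj r * canproj s)%g.
Proof. by rewrite -canproj_mul. Qed.

Lemma canproj1 : canproj 1%g = 1%g. Proof. by []. Qed.

Lemma canprojV r : canproj (r^-1)%g = ((canproj r)^-1)%g.
Proof. by rewrite -canproj_inv. Qed.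

Record quotSection := QuotSection {
  qsec :> quotGroup -> Gam;
  qsecK : cancel qsec canproj;
  qsec1 : qsec 1%g = 1%g
}.

End NormalSubgroupTheory.

Section BilinearFacts.
Variables (k : fieldType) (V W U : lmodType k) (f : V -> W -> U).
Hypothesis hf : bilinear_map f.

Lemma tlift_sumZ I (s : seq I) (c : I -> k) (v : I -> V) (w : I -> W) :
  tlift f (\sum_(i <- s) c i *: (v i ⊗ w i)) = \sum_(i <- s) c i *: f (v i) (w i).
Proof.
rewrite linear_sumZ; last exact: tlift_linear.
by apply: eq_bigr => i _; rewrite tlift_pure.
Qed.

End BilinearFacts.

Section FreeModule.
Variables (k : fieldType) (X : choiceType).
Local Notation B := {malg k[X]}.

(* The linear map taking the value [f x] at the basis vector [x]. *)
Definition mlin (V : lmodType k) (f : X -> V) (a : B) : V :=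
  \sum_(x <- msupp a) a@_x *: f x.

Lemma mlinEw (V : lmodType k) (f : X -> V) (a : B) (d : {fset X}) :
  (msupp a `<=` d)%fset -> mlin f a = \sum_(x <- d) a@_x *: f x.
Proof.
move=> le; rewrite /mlin (big_fset_incl _ le) //= => x _ /mcoeff_outdom ->.
by rewrite scale0r.
Qed.

Lemma mlin_is_linear (V : lmodType k) (f : X -> V) : linear (mlin f).
Proof.
move=> c a b.
pose d := (msupp (c *: a + b) `|` (msupp a `|` msupp b))%fset.
rewrite (@mlinEw _ _ _ d) ?fsubsetUl //.
rewrite (@mlinEw _ _ a d); last by rewrite /d fsetUCA fsubsetUl.
rewrite (@mlinEw _ _ b d); last by rewrite /d fsetUA fsubsetUr.
rewrite scaler_sumr -big_split /=; apply: eq_bigr => x _.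
by rewrite mcoeffD mcoeffZ scalerDl scalerA.
Qed.

HB.instance Definition _ (V : lmodType k) (f : X -> V) :=
  GRing.isLinear.Build k B V _ (mlin f) (mlin_is_linear f).

Lemma mlinU (V : lmodType k) (f : X -> V) x : mlin f << x >> = f x.
Proof.
by rewrite /mlin msuppU oner_eq0 big_seq_fset1 mcoeffUU scale1r.
Qed.

Lemma malg_span (a : B) : a = \sum_(x <- msupp a) a@_x *: << x >>.
Proof.
rewrite [LHS]monalgE; apply: eq_bigr => x _.
by apply/malgP => y; rewrite mcoeffZ !mcoeffU mulrnAr mulr1.
Qed.

Lemma malg_ext (V : lmodType k) (f g : B -> V) : linear f -> linear g ->
  (forall x, f << x >> = g << x >>) -> f =1 g.
Proof.
move=> hf hg e a; rewrite [a]malg_span !linear_sumZ //.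
by apply: eq_bigr => x _; rewrite e.
Qed.

End FreeModule.

Section TensorFacts.
Variable k : fieldType.
Implicit Types U V W : lmodType k.

Lemma bilinear_scale_flip V U (f : V -> k) : scalar f ->
  bilinear_map (fun (v : V) (u : U) => f v *: u).
Proof.
move=> hf; split=> [u a x y|v a x y] /=.
  by rewrite hf scalerDl scalerA.
by rewrite scalerDr !scalerA mulrC.
Qed.

Lemma bilinear_flip V W U (f : V -> W -> U) :
  bilinear_map f -> bilinear_map (fun w v => f v w).
Proof. by case. Qed.

Lemma bilinear_comp V W U V' W' (f : V' -> W' -> U) (g : V -> V') (h : W -> W') :
  bilinear_map f -> linear g -> linear h ->
  bilinear_map (fun v w => f (g v) (h w)).
Proof.
move=> [fl fr] hg hh; split=> [w a x y|v a x y] /=.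
  by rewrite hg; apply: (fl (h w)).
by rewrite hh; apply: (fr (g v)).
Qed.

Lemma idfun_linear V : linear (idfun : V -> V). Proof. by []. Qed.

Lemma tmap_linear V W V' W' (f : V -> V') (g : W -> W') :
  linear f -> linear g -> linear (tmap f g).
Proof.
by move=> hf hg; apply: tlift_linear; apply: bilinear_comp => //; apply: tpure_bilinear.
Qed.

Lemma tmap_pure V W V' W' (f : V -> V') (g : W -> W') v w :
  linear f -> linear g -> tmap f g (v ⊗ w) = f v ⊗ g w.
Proof.
move=> hf hg; rewrite /tmap tlift_pure //.
by apply: bilinear_comp => //; apply: tpure_bilinear.
Qed.

Lemma tlift_param U V W V' W' (F : V' -> W' -> V -> W -> U) (t : tensor V W) :
  (forall v w, bilinear_map (fun a b => F a b v w)) ->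
  bilinear_map (fun a b => tlift (F a b) t).
Proof.
move=> hF; split=> [b|a] c x y;
    rewrite /tlift /fsum /= scaler_sumr -big_split; apply: eq_bigr => p _.
  exact: ((hF p.1 p.2).1 b).
exact: (hF p.1 p.2).2.
Qed.

Lemma tassoc_inner U V W (w : W) :
  bilinear_map (fun (u : U) (v : V) => u ⊗ (v ⊗ w)).
Proof.
have [pl pr] := @tpure_bilinear _ U (tensor V W).
have [ql qr] := @tpure_bilinear _ V W.
split=> [v a x y|u a x y] /=; first exact: (pl (v ⊗ w)).
by have /= -> := ql w a x y; rewrite -(pr u).
Qed.

Lemma tassoc_bilinear U V W : bilinear_map
  (fun (t : tensor U V) (w : W) => tlift (fun u v => u ⊗ (v ⊗ w)) t).
Proof.
split=> [w|t a x y] /=; first exact/tlift_linear/tassoc_inner.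
rewrite /tlift /fsum scaler_sumr -big_split /=; apply: eq_bigr => p _.
have [_ pr] := @tpure_bilinear _ U (tensor V W).
have [_ qr] := @tpure_bilinear _ V W.
by rewrite qr pr.
Qed.

Lemma tassoc_linear U V W : linear (@tassoc _ U V W).
Proof. exact/tlift_linear/tassoc_bilinear. Qed.

Lemma tassoc_pure U V W (u : U) (v : V) (w : W) :
  tassoc ((u ⊗ v) ⊗ w) = u ⊗ (v ⊗ w).
Proof.
rewrite /tassoc tlift_pure; last exact: tassoc_bilinear.
by rewrite tlift_pure //; apply: tassoc_inner.
Qed.

End TensorFacts.

(* A Hopf algebra with basis [Q * H] whose structure constants have the shape
   common to smash coproducts and their quotients; [mb], [cb] and [sb] are the
   product, coproduct and antipode on basis vectors. *)
Section BasisHopf.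
Variables (k : fieldType) (H : finGroupType) (Q : groupType).
Local Notation X := (Q * H)%type.
Local Notation B := {malg k[X]}.
Local Notation e x h := (<< (x, h) >> : B).
Variables (dot : H -> Q -> Q).
Variables (sg : Q -> Q -> H -> k) (ta : H -> Q -> H -> k) (th : Q -> H -> k).
Variables (mb : X -> X -> B) (cb : X -> tensor B B) (sb : X -> B).

Hypothesis dot1 : forall x, dot 1%g x = x.
Hypothesis dotM : forall h l x, dot (h * l)%g x = dot h (dot l x).
Hypothesis dotMr : forall h x y, dot h (x * y)%g = (dot h x * dot h y)%g.

Hypothesis mbE : forall x h y h', mb (x, h) (y, h') =
  if h == h' then sg x y h *: e (x * y)%g h else 0.
Hypothesis cbE : forall x h, cb (x, h) =
  \sum_l ta l x h *: (e x l ⊗ e (dot l^-1 x) (l^-1 * h)%g).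
Hypothesis sbE : forall x h, sb (x, h) =
  th x h *: e (dot h^-1 x^-1) (h^-1)%g.

Hypothesis sgA : forall x y z h,
  sg x y h * sg (x * y)%g z h = sg y z h * sg x (y * z)%g h.
Hypothesis sg1x : forall x h, sg 1%g x h = 1.
Hypothesis sgx1 : forall x h, sg x 1%g h = 1.
Hypothesis sg_1 : forall x y, sg x y 1%g = 1.
Hypothesis taA : forall l m x h,
  ta l x h * ta m x l = ta m x h * ta (m^-1 * l)%g (dot m^-1 x) (m^-1 * h)%g.
Hypothesis ta_1 : forall x h, ta 1%g x h = 1.
Hypothesis ta_h : forall x h, ta h x h = 1.
Hypothesis ta1 : forall l h, ta l 1%g h = 1.
Hypothesis taM : forall l x y h, sg x y h * ta l (x * y)%g h =
  ta l x h * ta l y h * (sg x y l * sg (dot l^-1 x) (dot l^-1 y) (l^-1 * h)%g).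
Hypothesis thl : forall x l,
  ta l x 1%g * th x l * sg (dot l^-1 x^-1) (dot l^-1 x) l^-1 = 1.
Hypothesis thr : forall x l,
  ta l x 1%g * th (dot l^-1 x) l^-1 * sg x x^-1 l = 1.

Lemma dot1g h : dot h 1%g = 1%g.
Proof. by apply: (@mulgI _ (dot h 1%g)); rewrite -dotMr !mulg1. Qed.

Lemma dotV h x : dot h x^-1 = ((dot h x)^-1)%g.
Proof.
by apply: (@mulgI _ (dot h x)); rewrite -dotMr !mulgV dot1g.
Qed.

Definition bmul (a b : B) : B := mlin (fun p => mlin (mb p) b) a.
Definition bone : B := \sum_h e 1%g h.
Definition bcomul : B -> tensor B B := mlin cb.
Definition bcounit : B -> k := mlin (fun p : X => (p.2 == 1%g)%:R : k^o).
Definition bantipode : B -> B := mlin sb.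

Lemma bmul_bilinear : bilinear_map bmul.
Proof.
split=> [b|a c x y] /=; first exact: mlin_is_linear.
rewrite /bmul /mlin scaler_sumr -big_split /=; apply: eq_bigr => p _.
by rewrite -!/(mlin _ _) mlin_is_linear scalerDr !scalerA mulrC.
Qed.

Let mull b : linear (bmul^~ b) := bmul_bilinear.1 b.
Let mulr a : linear (bmul a) := bmul_bilinear.2 a.

Lemma bmulU p q : bmul << p >> << q >> = mb p q.
Proof. by rewrite /bmul !mlinU. Qed.

Lemma bmulE x h y h' : bmul (e x h) (e y h') =
  if h == h' then sg x y h *: e (x * y)%g h else 0.
Proof. by rewrite /bmul !mlinU mbE. Qed.

Lemma bcomulE x h : bcomul (e x h) =
  \sum_l ta l x h *: (e x l ⊗ e (dot l^-1 x) (l^-1 * h)%g).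
Proof. by rewrite /bcomul mlinU cbE. Qed.

Lemma bantipodeE x h : bantipode (e x h) = th x h *: e (dot h^-1 x^-1) (h^-1)%g.
Proof. by rewrite /bantipode mlinU sbE. Qed.

Lemma bcounitE x h : bcounit (e x h) = (h == 1%g)%:R.
Proof. by rewrite /bcounit mlinU. Qed.

Lemma bmulA : associative bmul.
Proof.
move=> a b c; symmetry.
apply: (malg_ext (f := fun a => bmul (bmul a b) c)
  (g := fun a => bmul a (bmul b c))); [|exact: mull|].
  by apply: (linear_comp_fun (f := bmul^~ c) (g := bmul^~ b)); apply: mull.
move=> [x h].
apply: (malg_ext (f := fun b => bmul (bmul (e x h) b) c)
  (g := fun b => bmul (e x h) (bmul b c))).
- by apply: (linear_comp_fun (f := bmul^~ c) (g := bmul (e x h))); [apply: mull|apply: mulr].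
- by apply: (linear_comp_fun (f := bmul (e x h)) (g := bmul^~ c)); [apply: mulr|apply: mull].
move=> [y h'].
apply: (malg_ext (f := fun c => bmul (bmul (e x h) (e y h')) c)
  (g := fun c => bmul (e x h) (bmul (e y h') c))).
- exact: mulr.
- by apply: (linear_comp_fun (f := bmul (e x h)) (g := bmul (e y h'))); apply: mulr.
move=> [z h''].
rewrite !bmulE; case: eqVneq => [->|n1].
  rewrite (linearZf _ _ (mull _)) bmulE; case: eqVneq => [->|n2]; last first.
    by rewrite scaler0 (linear0f (mulr _)).
  rewrite (linearZf _ _ (mulr _)) bmulE eqxx !scalerA mulgA.
  by congr (_ *: _); apply: sgA.
rewrite (linear0f (mull _)); case: eqVneq => [e1|n2]; last first.
  by rewrite (linear0f (mulr _)).
by rewrite (linearZf _ _ (mulr _)) bmulE (negPf n1) scaler0.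
Qed.

Lemma bmul1 : left_id bone bmul.
Proof.
move=> a; move: a; apply: (malg_ext (f := bmul bone) (g := idfun)); [exact: mulr|by []|].
move=> [x h]; rewrite /bone (linear_sumf _ _ (mull _)) (bigD1 h) //=.
rewrite bmulE eqxx sg1x scale1r mul1g big1 ?addr0 // => l nl.
by rewrite bmulE (negPf nl).
Qed.

Lemma b1mul : right_id bone bmul.
Proof.
apply: (malg_ext (f := bmul^~ bone) (g := idfun)); [exact: mull|by []|].
move=> [x h]; rewrite /bone (linear_sumf _ _ (mulr _)) (bigD1 h) //=.
rewrite bmulE eqxx sgx1 scale1r mulg1 big1 ?addr0 // => l nl.
by rewrite bmulE eq_sym (negPf nl).
Qed.

Lemma bmulDl : left_distributive bmul +%R.
Proof. by move=> a b c; apply: linearDf (mull c). Qed.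

Lemma bmulDr : right_distributive bmul +%R.
Proof. by move=> a b c; apply: linearDf (mulr a). Qed.

Lemma bscalerAl (c : k) a b : c *: bmul a b = bmul (c *: a) b.
Proof. by symmetry; apply: linearZf (mull b). Qed.

Lemma bscalerAr (c : k) a b : c *: bmul a b = bmul a (c *: b).
Proof. by symmetry; apply: linearZf (mulr a). Qed.

Lemma bcounit_scalar : scalar bcounit.
Proof. by move=> c a b; rewrite /bcounit mlin_is_linear. Qed.

Let eps_linear : linear (bcounit : B -> k^o) := bcounit_scalar.

Lemma bcounit1 : bcounit bone = 1.
Proof.
rewrite /bone (linear_sumf _ _ eps_linear) (bigD1 1%g) //=.
rewrite bcounitE eqxx big1 ?addr0 // => l nl.
by rewrite bcounitE (negPf nl).
Qed.

Lemma bone_neq0 : bone != 0.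
Proof.
apply/eqP => h; have := bcounit1; rewrite h (linear0f eps_linear) => /eqP.
by rewrite eq_sym oner_eq0.
Qed.

Lemma bcounitM : {morph bcounit : a b / bmul a b >-> a * b}.
Proof.
move=> a b.
apply: (malg_ext (f := fun a => bcounit (bmul a b) : k^o)
  (g := fun a => bcounit a * bcounit b : k^o)).
- exact: (linear_comp_fun eps_linear (mull b)).
- by move=> c x y; rewrite bcounit_scalar mulrDl -mulrA.
move=> [x h].
apply: (malg_ext (f := fun b => bcounit (bmul (e x h) b) : k^o)
  (g := fun b => bcounit (e x h) * bcounit b : k^o)).
- exact: (linear_comp_fun eps_linear (mulr _)).
- move=> c y z; rewrite bcounit_scalar mulrDr.
  by congr (_ + _); rewrite mulrCA.
move=> [y h']; rewrite !bcounitE bmulE; case: (eqVneq h h') => [<-|n1].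
  rewrite (linearZf _ _ eps_linear) bcounitE; case: eqVneq => [->|n2].
    by rewrite sg_1 scale1r mulr1.
  by rewrite scaler0 mulr0.
rewrite (linear0f eps_linear) -natrM mulnb.
by case: eqVneq => // e1; case: eqVneq => // e2; rewrite e1 e2 eqxx in n1.
Qed.

Lemma bcomul_linear : linear bcomul. Proof. exact: mlin_is_linear. Qed.
Lemma bantipode_linear : linear bantipode. Proof. exact: mlin_is_linear. Qed.

Lemma bcomulA (a : B) :
  tassoc (tmap bcomul idfun (bcomul a)) = tmap idfun bcomul (bcomul a).
Proof.
have hl := tmap_linear bcomul_linear (@idfun_linear _ B).
have hr := tmap_linear (@idfun_linear _ B) bcomul_linear.
apply: (malg_ext (f := fun a => tassoc (tmap bcomul idfun (bcomul a)))
  (g := fun a => tmap idfun bcomul (bcomul a))).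
- apply: (linear_comp_fun (@tassoc_linear _ B B B)).
  exact: (linear_comp_fun hl bcomul_linear).
- exact: (linear_comp_fun hr bcomul_linear).
move=> [x h]; rewrite bcomulE !linear_sumZ //; last exact: tassoc_linear.
pose F l m := (ta l x h * ta m x l) *:
  (e x m ⊗ (e (dot m^-1 x) (m^-1 * l)%g ⊗ e (dot l^-1 x) (l^-1 * h)%g)).
transitivity (\sum_l \sum_m F l m).
  apply: eq_bigr => l _; rewrite tmap_pure //; last exact: bcomul_linear.
  rewrite bcomulE.
  rewrite (linear_sumZ (f := fun t => tassoc (t ⊗ e (dot l^-1 x) (l^-1 * h)%g))).
    by rewrite scaler_sumr; apply: eq_bigr => m _; rewrite tassoc_pure scalerA.
  apply: (linear_comp_fun (@tassoc_linear _ B B B)).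
  exact: (@tpure_bilinear _ _ B).1.
rewrite exchange_big; apply: eq_bigr => m _ /=.
rewrite tmap_pure //; last exact: bcomul_linear.
rewrite bcomulE linear_sumZ; last exact: (@tpure_bilinear _ B (tensor B B)).2.
rewrite scaler_sumr [RHS](reindex_inj (mulgI (m^-1)%g)) /=; apply: eq_bigr => l _.
by rewrite scalerA /F taA -dotM !invgM invgK !mulgA !mulgK.
Qed.

Lemma bcomul_counitl (a : B) : tlift (fun x y => bcounit x *: y) (bcomul a) = a.
Proof.
have hb := @bilinear_scale_flip _ _ B _ bcounit_scalar.
apply: (malg_ext (g := idfun)
  (f := fun a => tlift (fun x y => bcounit x *: y) (bcomul a))) => //.
  exact: (linear_comp_fun (tlift_linear hb) bcomul_linear).
move=> [x h]; rewrite bcomulE tlift_sumZ // (bigD1 1%g) //=.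
rewrite bcounitE eqxx ta_1 !scale1r invg1 dot1 mul1g big1 ?addr0 // => l nl.
by rewrite bcounitE (negPf nl) scale0r scaler0.
Qed.

Lemma bcomul_counitr (a : B) : tlift (fun x y => bcounit y *: x) (bcomul a) = a.
Proof.
have hb := bilinear_flip (@bilinear_scale_flip _ _ B _ bcounit_scalar).
apply: (malg_ext (g := idfun)
  (f := fun a => tlift (fun x y => bcounit y *: x) (bcomul a))) => //.
  exact: (linear_comp_fun (tlift_linear hb) bcomul_linear).
move=> [x h]; rewrite bcomulE tlift_sumZ // (bigD1 h) //=.
rewrite bcounitE mulVg eqxx ta_h !scale1r big1 ?addr0 // => l nl.
rewrite bcounitE; case: eqVneq => [e1|]; last by rewrite scale0r scaler0.
case/eqP: nl; rewrite -[l]mulg1; apply: (mulgI l^-1%g).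
by rewrite mulKg e1.
Qed.

Definition btmul (s t : tensor B B) : tensor B B :=
  tlift (fun a b => tlift (fun a' b' => bmul a a' ⊗ bmul b b') t) s.

Let btmul_inner a b : bilinear_map (fun a' b' => bmul a a' ⊗ bmul b b').
Proof. by apply: bilinear_comp; [apply: tpure_bilinear|apply: mulr..]. Qed.

Let btmul_outer t : bilinear_map
  (fun a b => tlift (fun a' b' => bmul a a' ⊗ bmul b b') t).
Proof.
apply: tlift_param => v w.
by apply: (bilinear_comp (g := bmul^~ v) (h := bmul^~ w));
  [apply: tpure_bilinear|apply: mull..].
Qed.

Lemma btmul_linearl t : linear (btmul^~ t).
Proof. exact: tlift_linear. Qed.

Lemma btmul_linearr s : linear (btmul s).
Proof.
move=> c x y; rewrite /btmul /tlift /fsum scaler_sumr -big_split /=.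
by apply: eq_bigr => p _; apply: (tlift_linear (btmul_inner p.1 p.2)).
Qed.

Lemma bcomul1 : bcomul bone = bone ⊗ bone.
Proof.
have [pl pr] := @tpure_bilinear k B B.
rewrite {1}/bone linear_sumf; last exact: bcomul_linear.
rewrite {1}/bone (linear_sumf _ _ (pl _)).
under eq_bigr => h _ do rewrite bcomulE.
rewrite exchange_big; apply: eq_bigr => l _ /=.
rewrite [in RHS]/bone (linear_sumf _ _ (pr _)) (reindex_inj (mulgI l)) /=.
by apply: eq_bigr => h _; rewrite ta1 scale1r dot1g mulKg.
Qed.

Lemma bcomulM (a b : B) : bcomul (bmul a b) = btmul (bcomul a) (bcomul b).
Proof.
apply: (malg_ext (f := fun a => bcomul (bmul a b))
  (g := fun a => btmul (bcomul a) (bcomul b))).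
- exact: (linear_comp_fun bcomul_linear (mull b)).
- exact: (linear_comp_fun (btmul_linearl _) bcomul_linear).
move=> [x h].
apply: (malg_ext (f := fun b => bcomul (bmul (e x h) b))
  (g := fun b => btmul (bcomul (e x h)) (bcomul b))).
- exact: (linear_comp_fun bcomul_linear (mulr _)).
- exact: (linear_comp_fun (btmul_linearr _) bcomul_linear).
move=> [y h']; rewrite bmulE !bcomulE /btmul tlift_sumZ //.
have pl (w : B) : linear (fun v => v ⊗ w) := (@tpure_bilinear k B B).1 w.
have pr (v : B) : linear (fun w => v ⊗ w) := (@tpure_bilinear k B B).2 v.
under [RHS]eq_bigr => l _.
  rewrite tlift_sumZ // (bigD1 l) //= big1 ?addr0; last first.
    move=> m nm; rewrite bmulE eq_sym (negPf nm) (linear0f (pl _)) scaler0.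
    by [].
  rewrite !bmulE eqxx (inj_eq (mulgI _)).
  over.
case: eqVneq => [->|n1]; last first.
  rewrite (linear0f bcomul_linear) big1 // => l _.
  by rewrite (linear0f (pr _)) !scaler0.
rewrite (linearZf _ _ bcomul_linear) bcomulE scaler_sumr.
apply: eq_bigr => l _.
by rewrite (linearZf _ _ (pl _)) (linearZf _ _ (pr _)) !scalerA taM dotMr !mulrA.
Qed.

Lemma bantipodel (a : B) :
  tlift (fun x y => bmul (bantipode x) y) (bcomul a) = bcounit a *: bone.
Proof.
have hb : bilinear_map (fun x y => bmul (bantipode x) y).
  by apply: (bilinear_comp bmul_bilinear bantipode_linear); apply: idfun_linear.
apply: (malg_ext (g := fun a => bcounit a *: bone)
  (f := fun a => tlift (fun x y => bmul (bantipode x) y) (bcomul a))).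
- exact: (linear_comp_fun (tlift_linear hb) bcomul_linear).
- exact: (bilinear_scale_flip _ bcounit_scalar).1.
move=> [x h]; rewrite bcomulE tlift_sumZ // bcounitE.
under eq_bigr => l _.
  rewrite bantipodeE (linearZf _ _ (mull _)) bmulE scalerA.
  rewrite -[X in X == _]mulg1 (inj_eq (mulgI _)) eq_sym.
  over.
case: eqVneq => [->|n1]; last by rewrite big1 ?scale0r // => l _; rewrite scaler0.
rewrite scale1r /bone [RHS](reindex_inj invg_inj) /=; apply: eq_bigr => l _.
by rewrite scalerA thl scale1r -dotMr mulVg dot1g.
Qed.

Lemma bantipoder (a : B) :
  tlift (fun x y => bmul x (bantipode y)) (bcomul a) = bcounit a *: bone.
Proof.
have hb : bilinear_map (fun x y => bmul x (bantipode y)).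
  apply: (bilinear_comp (g := idfun) bmul_bilinear _ bantipode_linear).
  exact: idfun_linear.
apply: (malg_ext (g := fun a => bcounit a *: bone)
  (f := fun a => tlift (fun x y => bmul x (bantipode y)) (bcomul a))).
- exact: (linear_comp_fun (tlift_linear hb) bcomul_linear).
- exact: (bilinear_scale_flip _ bcounit_scalar).1.
move=> [x h]; rewrite bcomulE tlift_sumZ // bcounitE.
under eq_bigr => l _.
  rewrite bantipodeE (linearZf _ _ (mulr _)) bmulE scalerA invgM invgK.
  rewrite -[X in X == _]mul1g (inj_eq (mulIg _)) eq_sym invg_eq1.
  over.
case: eqVneq => [->|n1]; last by rewrite big1 ?scale0r // => l _; rewrite scaler0.
rewrite scale1r /bone; apply: eq_bigr => l _.
by rewrite scalerA invg1 mulg1 mul1g -dotV -dotM mulgV dot1 thr scale1r mulgV.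
Qed.

End BasisHopf.

(* [k^H] with pointwise operations, hence the basis of Dirac functions. *)
Definition funAlg (k : fieldType) (H : finGroupType) : Type := {ffun H -> k}.

Section FunAlgebra.
Variables (k : fieldType) (H : finGroupType).
Local Notation kH := (funAlg k H).

HB.instance Definition _ := Choice.on kH.
HB.instance Definition _ := GRing.Lmodule.copy kH {ffun H -> k^o}.
HB.instance Definition _ := GRing.PzRing.copy kH {ffun H -> k^o}.

Fact funAlg_neq0 : (1 : kH) != 0.
Proof. by apply/eqP => /ffunP/(_ 1%g)/eqP; rewrite !ffunE oner_eq0. Qed.

HB.instance Definition _ := GRing.PzSemiRing_isNonZero.Build kH funAlg_neq0.

Fact funAlg_mulC : commutative ( *%R : kH -> kH -> kH).
Proof. by move=> f g; apply/ffunP => h; rewrite !ffunE mulrC. Qed.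

HB.instance Definition _ := GRing.PzRing_hasCommutativeMul.Build kH funAlg_mulC.

Fact funAlg_scalerAl (c : k) (f g : kH) : c *: (f * g) = (c *: f) * g.
Proof. by apply/ffunP => h; rewrite !ffunE; apply: mulrA. Qed.

HB.instance Definition _ := GRing.Lmodule_isLalgebra.Build k kH funAlg_scalerAl.

Fact funAlg_scalerAr (c : k) (f g : kH) : c *: (f * g) = f * (c *: g).
Proof. by apply/ffunP => h; rewrite !ffunE; apply: mulrCA. Qed.

HB.instance Definition _ := GRing.Lalgebra_isAlgebra.Build k kH funAlg_scalerAr.

Definition dirac (h : H) : kH := [ffun x => (x == h)%:R].

Lemma funAlg_span (f : kH) : f = \sum_h f h *: dirac h.
Proof.
apply/ffunP => x; rewrite sum_ffunE (bigD1 x) //= !ffunE eqxx big1.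
  by rewrite addr0; symmetry; apply: mulr1.
move=> h nh; rewrite !ffunE eq_sym (negPf nh); exact: mulr0.
Qed.

(* [Δ f] is the function [(h, l) |-> f (h * l)] on [H * H]. *)
Definition fcomul (f : kH) : tensor kH kH :=
  \sum_h \sum_l f (h * l)%g *: (dirac h ⊗ dirac l).
Definition fcounit (f : kH) : k := f 1%g.
Definition fantipode (f : kH) : kH := [ffun h => f (h^-1)%g].

Fact fcomul_linear : linear fcomul.
Proof.
move=> c f g; rewrite /fcomul scaler_sumr -big_split; apply: eq_bigr => h _.
rewrite scaler_sumr -big_split; apply: eq_bigr => l _ /=.
by rewrite !ffunE scalerDl scalerA.
Qed.
Fact fcounit_scalar : scalar fcounit.
Proof. by move=> c f g; rewrite /fcounit !ffunE. Qed.
Fact fantipode_linear : linear fantipode.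
Proof. by move=> c f g; apply/ffunP => h; rewrite !ffunE. Qed.

Lemma diracM h (f : kH) : dirac h * f = f h *: dirac h.
Proof.
apply/ffunP => x; rewrite !ffunE; case: eqVneq => [->|n1].
  by rewrite mul1r; symmetry; apply: mulr1.
by rewrite mul0r; symmetry; apply: mulr0.
Qed.

Lemma tlift_fcomul (U : lmodType k) (F : kH -> kH -> U) f : bilinear_map F ->
  tlift F (fcomul f) = \sum_h \sum_l f (h * l)%g *: F (dirac h) (dirac l).
Proof.
move=> hF; rewrite /fcomul linear_sumf; last exact: tlift_linear.
by apply: eq_bigr => h _; rewrite tlift_sumZ.
Qed.

Let tpl (w : kH) : linear (fun v : kH => v ⊗ w) := (@tpure_bilinear k kH kH).1 w.
Let tpr (v : kH) : linear (fun w : kH => v ⊗ w) := (@tpure_bilinear k kH kH).2 v.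

Lemma diracE h x : dirac h x = (x == h)%:R. Proof. by rewrite ffunE. Qed.

Lemma sum_diracl (U : lmodType k) (F : H -> U) (h : H) :
  \sum_x (dirac h x) *: F x = F h.
Proof.
rewrite (bigD1 h) //= diracE eqxx scale1r big1 ?addr0 // => x nx.
by rewrite diracE (negPf nx) scale0r.
Qed.

Lemma fcomul_dirac h : fcomul (dirac h) =
  \sum_l dirac l ⊗ dirac (l^-1 * h)%g.
Proof.
rewrite /fcomul; apply: eq_bigr => l _.
rewrite (reindex_inj (mulgI (l^-1)%g)) /=.
under eq_bigr => m _ do rewrite mulKVg.
by rewrite (sum_diracl (fun m => dirac l ⊗ dirac (l^-1 * m)%g)).
Qed.

Lemma fcomulA f :
  tassoc (tmap fcomul idfun (fcomul f)) = tmap idfun fcomul (fcomul f).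
Proof.
have bl : bilinear_map (fun v w : kH => fcomul v ⊗ w).
  by apply: (bilinear_comp _ fcomul_linear); [apply: tpure_bilinear|].
have br : bilinear_map (fun v w : kH => v ⊗ fcomul w).
  by apply: (bilinear_comp _ _ fcomul_linear); [apply: tpure_bilinear|].
rewrite /tmap !tlift_fcomul // linear_sumf; last exact: tassoc_linear.
pose F h l m := f (h * l * m)%g *: (dirac h ⊗ (dirac l ⊗ dirac m)).
transitivity (\sum_h \sum_l \sum_m F h l m); last first.
  apply: eq_bigr => h _; rewrite exchange_big /=.
  transitivity (\sum_m \sum_l f (h * m)%g *:
      (dirac h ⊗ (dirac l ⊗ dirac (l^-1 * m)%g))).
    rewrite exchange_big [RHS]exchange_big; apply: eq_bigr => l _.
    rewrite [RHS](reindex_inj (mulgI l)) /=; apply: eq_bigr => m _.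
    by rewrite /F mulgA mulKg.
  apply: eq_bigr => m _; rewrite fcomul_dirac linear_sumf ?scaler_sumr //.
  exact: (@tpure_bilinear k kH (tensor kH kH)).2.
have tl (w : kH) : linear (fun t : tensor kH kH => tassoc (t ⊗ w)).
  apply: (linear_comp_fun (@tassoc_linear _ kH kH kH)).
  exact: (@tpure_bilinear k (tensor kH kH) kH).1.
under [RHS]eq_bigr => h _ do rewrite exchange_big.
rewrite [RHS]exchange_big /=.
transitivity (\sum_l \sum_m f (l * m)%g *:
    tassoc (fcomul (dirac l) ⊗ dirac m)).
  by apply: eq_bigr => l _; rewrite linear_sumZ //; apply: tassoc_linear.
rewrite exchange_big; apply: eq_bigr => m _ /=.
transitivity (\sum_l \sum_h f (l * m)%g *:
    (dirac h ⊗ (dirac (h^-1 * l)%g ⊗ dirac m))).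
  apply: eq_bigr => l _; rewrite fcomul_dirac (linear_sumf _ _ (tl _)) scaler_sumr.
  by apply: eq_bigr => h _; rewrite tassoc_pure.
rewrite exchange_big; apply: eq_bigr => h _ /=.
by rewrite (reindex_inj (mulgI h)) /=; apply: eq_bigr => l _; rewrite mulKg.
Qed.

Lemma fcomul_counitl f : tlift (fun x y => fcounit x *: y) (fcomul f) = f.
Proof.
rewrite tlift_fcomul; last exact: (bilinear_scale_flip _ fcounit_scalar).
rewrite exchange_big /= [RHS]funAlg_span; apply: eq_bigr => l _.
rewrite (bigD1 1%g) //= {1}/fcounit diracE eqxx scale1r mul1g big1 ?addr0 //.
move=> h nh; rewrite /fcounit diracE eq_sym (negPf nh).
by rewrite scale0r scaler0.
Qed.

Lemma fcomul_counitr f : tlift (fun x y => fcounit y *: x) (fcomul f) = f.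
Proof.
rewrite tlift_fcomul;
  last exact: (bilinear_flip (bilinear_scale_flip _ fcounit_scalar)).
rewrite [RHS]funAlg_span; apply: eq_bigr => l _.
rewrite (bigD1 1%g) //= {1}/fcounit diracE eqxx scale1r mulg1 big1 ?addr0 //.
move=> h nh; rewrite /fcounit diracE eq_sym (negPf nh).
by rewrite scale0r scaler0.
Qed.

Lemma funAlg1E : (1 : kH) = \sum_h dirac h.
Proof.
rewrite [LHS]funAlg_span; apply: eq_bigr => h _.
by rewrite ffunE scale1r.
Qed.

Lemma fcomul1 : fcomul 1 = 1 ⊗ 1.
Proof.
rewrite {2}funAlg1E (linear_sumf _ _ (tpl _)); apply: eq_bigr => h _.
rewrite funAlg1E (linear_sumf _ _ (tpr _)); apply: eq_bigr => l _.
by rewrite -funAlg1E ffunE scale1r.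
Qed.

Lemma fcomulM f g : fcomul (f * g) = tmul (fcomul f) (fcomul g).
Proof.
have mulr (a : kH) : linear ( *%R a) by move=> c x y; rewrite mulrDr scalerAr.
have mull (a : kH) : linear ( *%R^~ a).
  by move=> c x y; rewrite mulrDl -scalerAl.
have bi (a b : kH) : bilinear_map (fun a' b' : kH => (a * a') ⊗ (b * b')).
  by apply: bilinear_comp; [apply: tpure_bilinear|apply: mulr..].
rewrite /tmul tlift_fcomul; last first.
  apply: tlift_param => v w.
  by apply: (bilinear_comp (g := *%R^~ v) (h := *%R^~ w));
    [apply: tpure_bilinear|apply: mull..].
rewrite /fcomul; apply: eq_bigr => h _; apply: eq_bigr => l _.
rewrite -/(fcomul g) tlift_fcomul // ffunE -scalerA; congr (_ *: _).
rewrite (bigD1 h) //= [X in _ + X]big1 ?addr0; last first.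
  move=> h' nh; rewrite big1 // => l' _; rewrite diracM diracE eq_sym (negPf nh).
  by rewrite scale0r (linear0f (tpl _)) scaler0.
rewrite (bigD1 l) //= big1 ?addr0; last first.
  move=> l' nl; rewrite [dirac l * _]diracM diracE eq_sym (negPf nl).
  by rewrite scale0r (linear0f (tpr _)) scaler0.
by rewrite !diracM !diracE !eqxx !scale1r.
Qed.

Lemma fcounitM : {morph fcounit : f g / f * g}.
Proof. by move=> f g; rewrite /fcounit ffunE. Qed.

Lemma fantipode_dirac h : fantipode (dirac h) = dirac h^-1.
Proof. by apply/ffunP => x; rewrite !ffunE (can2_eq invgK invgK). Qed.

Lemma fantipodel f :
  tlift (fun x y => fantipode x * y) (fcomul f) = (fcounit f)%:A.
Proof.
rewrite tlift_fcomul; last first.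
  split=> [w|v] c x y /=; first by rewrite fantipode_linear mulrDl -scalerAl.
  by rewrite mulrDr scalerAr.
rewrite exchange_big funAlg1E scaler_sumr; apply: eq_bigr => l _ /=.
rewrite (bigD1 l^-1%g) //= mulVg fantipode_dirac invgK.
rewrite diracM diracE eqxx scale1r big1 ?addr0 // => h nh.
rewrite fantipode_dirac diracM diracE -(inj_eq invg_inj) invgK (negPf nh).
by rewrite scale0r scaler0.
Qed.

Lemma fantipoder f :
  tlift (fun x y => x * fantipode y) (fcomul f) = (fcounit f)%:A.
Proof.
rewrite tlift_fcomul; last first.
  split=> [w|v] c x y /=; first by rewrite mulrDl -scalerAl.
  by rewrite fantipode_linear mulrDr scalerAr.
rewrite funAlg1E scaler_sumr; apply: eq_bigr => l _ /=.
rewrite (bigD1 l^-1%g) //= mulgV fantipode_dirac invgK.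
rewrite diracM diracE eqxx scale1r big1 ?addr0 // => h nh.
rewrite fantipode_dirac diracM diracE -(inj_eq invg_inj) invgK eq_sym (negPf nh).
by rewrite scale0r scaler0.
Qed.

Fact fcounit1 : fcounit 1 = 1. Proof. by rewrite /fcounit ffunE. Qed.

HB.instance Definition _ := Algebra_isHopf.Build k kH
  fcomul_linear fcounit_scalar fantipode_linear fcomulA
  fcomul_counitl fcomul_counitr fcomul1 fcomulM fcounit1 fcounitM
  fantipodel fantipoder.

End FunAlgebra.

Section Sharp.
Variables (k : fieldType) (H : finGroupType) (Q : choiceType).
Local Notation kH := (funAlg k H).
Local Notation B := {malg k[(Q * H)%type]}.

(* [k[Q] ⊗ k^H] is the free module on [Q * H]; [sharp x f] is [x # f]. *)
Definition sharp (x : Q) (f : kH) : B := \sum_h f h *: << (x, h) >>.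

Lemma sharp_dirac x h : sharp x (dirac k h) = << (x, h) >>.
Proof. by rewrite /sharp (sum_diracl (fun h => << (x, h) >> : B)). Qed.

Lemma sharp_linear x : linear (sharp x).
Proof.
move=> c f g; rewrite /sharp scaler_sumr -big_split; apply: eq_bigr => h _ /=.
by rewrite !ffunE scalerDl scalerA.
Qed.

Lemma sharp_diracl x h f : sharp x (dirac k h * f) = f h *: << (x, h) >>.
Proof. by rewrite diracM (linearZf _ _ (sharp_linear x)) sharp_dirac. Qed.

End Sharp.

Definition smash (k : fieldType) (H : finGroupType) (Gam : groupType)
    (act : autAction H Gam) : Type := {malg k[(Gam * H)%type]}.

Section Smash.
Variables (k : fieldType) (H : finGroupType) (Gam : groupType).
Variables (act : autAction H Gam).
Local Notation A := (smash k act).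
Local Notation δ := (@dirac k H).

HB.instance Definition _ := Choice.on A.
HB.instance Definition _ := GRing.Lmodule.on A.

Definition smash_elt (r : Gam) (f : funAlg k H) : A := sharp r f.
Local Notation "r # f" := (smash_elt r f) (at level 37).

Definition smash_mul : A -> A -> A :=
  bmul (fun p q => (p.1 * q.1)%g # (δ p.2 * δ q.2)).
Definition smash_comul : A -> tensor A A :=
  bcomul (fun p => \sum_l
    (p.1 # δ l) ⊗ (act l^-1%g p.1 # δ (l^-1 * p.2)%g)).
Definition smash_counit : A -> k := @bcounit k H Gam.
Definition smash_antipode : A -> A :=
  bantipode (fun p => act p.2^-1%g p.1^-1%g # δ p.2^-1%g).
Definition smash_one : A := 1%g # 1.

Let mbE x h y h' : (x * y)%g # (δ h * δ h') =
  if h == h' then (1 : k) *: << ((x * y)%g, h) >> else 0.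
Proof.
rewrite /smash_elt sharp_diracl diracE.
by case: eqVneq; rewrite ?scale0r.
Qed.

Let cbE x h : \sum_l (x # δ l) ⊗ (act l^-1%g x # δ (l^-1 * h)%g) =
  \sum_l (1 : k) *: ((<< (x, l) >> : A) ⊗ (<< (act l^-1%g x, l^-1 * h)%g >> : A)).
Proof. by apply: eq_bigr => l _; rewrite /smash_elt !sharp_dirac scale1r. Qed.

Let sbE x h : act h^-1%g x^-1%g # δ h^-1%g =
  (1 : k) *: << (act h^-1%g x^-1%g, h^-1%g) >>.
Proof. by rewrite /smash_elt !sharp_dirac scale1r. Qed.

Let oneE : smash_one = @bone k H Gam.
Proof.
rewrite /smash_one /smash_elt funAlg1E (linear_sumf _ _ (sharp_linear _)).
by apply: eq_bigr => h _; rewrite sharp_dirac.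
Qed.

Fact smash_mulA : associative smash_mul.
Proof. by apply: (bmulA (sg := fun _ _ _ => 1)) => [*|*]; [apply: mbE|]. Qed.
Fact smash_mul1 : left_id smash_one smash_mul.
Proof. by rewrite oneE; apply: (bmul1 (sg := fun _ _ _ => 1)) => [*|//]; apply: mbE. Qed.
Fact smash_1mul : right_id smash_one smash_mul.
Proof. by rewrite oneE; apply: (b1mul (sg := fun _ _ _ => 1)) => [*|//]; apply: mbE. Qed.
Fact smash_mulDl : left_distributive smash_mul +%R.
Proof. exact: bmulDl. Qed.
Fact smash_mulDr : right_distributive smash_mul +%R.
Proof. exact: bmulDr. Qed.
Fact smash_one_neq0 : smash_one != 0.
Proof. by rewrite oneE bone_neq0. Qed.

HB.instance Definition _ := GRing.Zmodule_isNzRing.Build A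
  smash_mulA smash_mul1 smash_1mul smash_mulDl smash_mulDr smash_one_neq0.

Fact smash_scalerAl (c : k) (a b : A) : c *: (a * b) = (c *: a) * b.
Proof. exact: bscalerAl. Qed.

HB.instance Definition _ := GRing.Lmodule_isLalgebra.Build k A smash_scalerAl.

Fact smash_scalerAr (c : k) (a b : A) : c *: (a * b) = a * (c *: b).
Proof. exact: bscalerAr. Qed.

HB.instance Definition _ := GRing.Lalgebra_isAlgebra.Build k A smash_scalerAr.

Fact smash_comul_linear : linear smash_comul.
Proof. exact: bcomul_linear. Qed.
Fact smash_counit_scalar : scalar smash_counit.
Proof. exact: bcounit_scalar. Qed.
Fact smash_antipode_linear : linear smash_antipode.
Proof. exact: bantipode_linear. Qed.

Local Notation s1 := (fun _ _ _ => 1).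
Local Notation t1 := (fun _ _ => 1).

Fact smash_comulA (a : A) :
  tassoc (tmap smash_comul idfun (smash_comul a)) =
  tmap idfun smash_comul (smash_comul a).
Proof.
by apply: (bcomulA (ta := s1) (dot := act)) => [*|*|//];
  [apply: aut_actM|apply: cbE].
Qed.
Fact smash_comul_counitl (a : A) :
  tlift (fun x y => smash_counit x *: y) (smash_comul a) = a.
Proof.
by apply: (bcomul_counitl (ta := s1) (dot := act)) => [*|*|//];
  [apply: aut_act1|apply: cbE].
Qed.
Fact smash_comul_counitr (a : A) :
  tlift (fun x y => smash_counit y *: x) (smash_comul a) = a.
Proof.
by apply: (bcomul_counitr (ta := s1) (dot := act)) => [*|//]; apply: cbE.
Qed.
Fact smash_comul1 : smash_comul 1 = 1 ⊗ 1.
Proof.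
rewrite -[1]/smash_one oneE.
by apply: (bcomul1 (ta := s1) (dot := act)) => [*|*|//];
  [apply: aut_actMr|apply: cbE].
Qed.
Fact smash_comulM (a b : A) :
  smash_comul (a * b) = tmul (smash_comul a) (smash_comul b).
Proof.
apply: (bcomulM (sg := s1) (ta := s1) (dot := act)) => *.
- exact: aut_actMr.
- exact: mbE.
- exact: cbE.
- by rewrite !mulr1.
Qed.
Fact smash_counit1 : smash_counit 1 = 1.
Proof. by rewrite -[1]/smash_one oneE; apply: bcounit1. Qed.
Fact smash_counitM : {morph smash_counit : a b / a * b}.
Proof. by apply: (bcounitM (sg := s1)) => [*|//]; apply: mbE. Qed.
Fact smash_antipodel (a : A) :
  tlift (fun x y => smash_antipode x * y) (smash_comul a) = (smash_counit a)%:A.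
Proof.
rewrite -[1]/smash_one oneE.
apply: (bantipodel (sg := s1) (ta := s1) (th := t1) (dot := act)) => *.
- exact: aut_actMr.
- exact: mbE.
- exact: cbE.
- exact: sbE.
- by rewrite !mulr1.
Qed.
Fact smash_antipoder (a : A) :
  tlift (fun x y => x * smash_antipode y) (smash_comul a) = (smash_counit a)%:A.
Proof.
rewrite -[1]/smash_one oneE.
apply: (bantipoder (sg := s1) (ta := s1) (th := t1) (dot := act)) => *.
- exact: aut_act1.
- exact: aut_actM.
- exact: aut_actMr.
- exact: mbE.
- exact: cbE.
- exact: sbE.
- by rewrite !mulr1.
Qed.

HB.instance Definition _ := Algebra_isHopf.Build k A
  smash_comul_linear smash_counit_scalar smash_antipode_linear smash_comulA
  smash_comul_counitl smash_comul_counitr smash_comul1 smash_comulM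
  smash_counit1 smash_counitM smash_antipodel smash_antipoder.

Lemma smash_eltM r s f g : (r # f) * (s # g) = (r * s)%g # (f * g).
Proof.
have lin x : linear (smash_elt x) by apply: sharp_linear.
rewrite [f]funAlg_span (linear_sumf _ _ (lin _)) mulr_suml [in RHS]mulr_suml.
rewrite (linear_sumf _ _ (lin _)).
apply: eq_bigr => h _.
rewrite -scalerAl !(linearZf _ _ (lin _)) -[LHS]scalerAl; congr (_ *: _).
rewrite [g]funAlg_span (linear_sumf _ _ (lin _)) mulr_sumr [in RHS]mulr_sumr.
rewrite (linear_sumf _ _ (lin _)).
apply: eq_bigr => l _.
rewrite -scalerAr !(linearZf _ _ (lin _)) -[LHS]scalerAr; congr (_ *: _).
by rewrite {1 2}/smash_elt !sharp_dirac; apply: bmulU.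
Qed.

Lemma smash_comulE r h : comul (r # δ h) =
  \sum_l (r # δ l) ⊗ (act l^-1%g r # δ (l^-1 * h)%g).
Proof. by rewrite {1}/smash_elt sharp_dirac; apply: mlinU. Qed.

Lemma smash_counitE r h : counit (r # δ h) = (h == 1%g)%:R.
Proof. by rewrite /smash_elt sharp_dirac; apply: bcounitE. Qed.

Lemma smash_antipodeE r h :
  antipode (r # δ h) = act h^-1%g r^-1%g # δ h^-1%g.
Proof. by rewrite {1}/smash_elt sharp_dirac; apply: mlinU. Qed.

Definition funAlg_incl (f : funAlg k H) : A := 1%g # f.

Fact funAlg_incl_linear : linear funAlg_incl.
Proof. exact: sharp_linear. Qed.
Fact funAlg_incl_monoid : monoid_morphism funAlg_incl.
Proof. by split=> // f g; rewrite /funAlg_incl smash_eltM mulg1. Qed.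

HB.instance Definition _ := GRing.isLinear.Build k (funAlg k H) A _
  funAlg_incl funAlg_incl_linear.
HB.instance Definition _ := GRing.isMonoidMorphism.Build (funAlg k H) A
  funAlg_incl funAlg_incl_monoid.

Lemma funAlg_incl_hopf : hopf_map funAlg_incl.
Proof.
have lin : linear (smash_elt 1%g) by apply: sharp_linear.
have cl : linear (comul : A -> _) by apply: comul_linear.
have fl : linear (comul : funAlg k H -> _) by apply: comul_linear.
have tl : linear (tmap funAlg_incl funAlg_incl) by apply: tmap_linear.
split=> f.
  change (comul (1%g # f) = tmap funAlg_incl funAlg_incl (comul f)).
  rewrite [f]funAlg_span (linear_sumZ _ _ _ lin) (linear_sumZ _ _ _ cl).
  rewrite (linear_sumZ _ _ _ fl) (linear_sumZ _ _ _ tl).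
  apply: eq_bigr => h _; congr (_ *: _).
  rewrite smash_comulE [comul _]fcomul_dirac (linear_sumf _ _ tl).
  by apply: eq_bigr => l _; rewrite tmap_pure // aut_act1g.
change (counit (1%g # f) = counit f).
have al : linear (counit : A -> k^o) by apply: counit_scalar.
have gl : linear (counit : funAlg k H -> k^o) by apply: counit_scalar.
rewrite [f]funAlg_span (linear_sumZ _ _ _ lin) (linear_sumZ _ _ _ al).
rewrite (linear_sumZ _ _ _ gl); apply: eq_bigr => h _.
have e : counit (1%g # δ h) = counit (δ h).
  by rewrite smash_counitE [RHS]diracE eq_sym.
exact: (congr1 ( *%R (f h)) e).
Qed.

End Smash.

(* Quotient data [(G, N, Φ)]; [Φ] is given as a function on the whole of [Gam]
   with values in the functions on the whole of [H], but only its values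
   [Φ r h] for [r] in [N] and [h] in [G] matter. *)
Definition quotient_data (k : fieldType) (H : finGroupType) (Gam : groupType)
    (act : autAction H Gam) (G : {group H}) (N : normalSubgroup Gam)
    (Φ : Gam -> funAlg k H) : Prop :=
  [/\ {in N & G, forall r h, act h r \in N},
      {in N & G, forall r h, Φ r h != 0},
      {in N &, forall r s, {in G, forall h, Φ (r * s)%g h = Φ r h * Φ s h}},
      {in N, forall r, {in G &, forall l h,
        Φ r (l * h)%g = Φ (act l^-1%g r) h * Φ r l}} &
      {in N & G, forall r h, forall s, Φ r h = Φ (s * r * s^-1)%g h}].

(* A quotient datum whose subgroup [G] is the whole of [H]. *)
Record quotDatum (k : fieldType) (H : finGroupType) (Gam : groupType)
    (act : autAction H Gam) := QuotDatum {
  qd_sub : normalSubgroup Gam;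
  qd_fun : Gam -> funAlg k H;
  qd_proof : quotient_data act [set: H]%G qd_sub qd_fun
}.

Definition crossed (k : fieldType) (H : finGroupType) (Gam : groupType)
    (act : autAction H Gam) (d : quotDatum k act) (j : quotSection (qd_sub d)) :
    Type := {malg k[(quotGroup (qd_sub d) * H)%type]}.

Section Crossed.
Variables (k : fieldType) (H : finGroupType) (Gam : groupType).
Variables (act : autAction H Gam) (d : quotDatum k act).
Variables (j : quotSection (qd_sub d)).
Local Notation N := (qd_sub d).
Local Notation Φ := (qd_fun d).
Local Notation C := (crossed j).
Local Notation δ := (@dirac k H).
Local Notation u := (@canproj Gam N).

HB.instance Definition _ := Choice.on C.
HB.instance Definition _ := GRing.Lmodule.on C.

Definition crossed_elt (x : quotGroup N) (f : funAlg k H) : C := sharp x f.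
Local Notation "x # f" := (crossed_elt x f) (at level 37).

(* In each formula the coset [u r] is represented by [r = j x]; see
   [crossed_comulE] and [crossed_antipodeE] for other representatives. *)
Definition crossed_mul : C -> C -> C :=
  bmul (fun p q => (p.1 * q.1)%g #
    (δ p.2 * δ q.2 * Φ (j p.1 * j q.1 * (j (p.1 * q.1))^-1)%g)).
Definition crossed_comul : C -> tensor C C :=
  bcomul (fun p => let r := j p.1 in \sum_l
    (u r # δ l^-1%g) ⊗
    (u (act l r) # (δ (l * p.2)%g * Φ (act l (j (u r)) * (j (u (act l r)))^-1)%g))).
Definition crossed_counit : C -> k := @bcounit k H (quotGroup N).
Definition crossed_antipode : C -> C :=
  bantipode (fun p => let r := j p.1 in let h := p.2 in
    u (act h^-1 r^-1)%g #
      (Φ ((j (u (act h^-1 r^-1)))^-1 * act h^-1 (j (u r))^-1)%g * δ h^-1%g)).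
Definition crossed_one : C := u 1%g # 1.

Lemma memN_proj r : (r \in N) = (u r == 1%g).
Proof. by rewrite -canproj1 canproj_eq invg1 mulg1. Qed.

Let stable r h : r \in N -> act h r \in N.
Proof. by move=> hr; have [st _ _ _ _] := qd_proof d; apply: st; rewrite ?inE. Qed.
Let ΦM r s h : r \in N -> s \in N -> Φ (r * s)%g h = Φ r h * Φ s h.
Proof.
by move=> hr hs; have [_ _ hM _ _] := qd_proof d; apply: hM; rewrite ?inE.
Qed.
Let Φc r l h : r \in N -> Φ r (l * h)%g = Φ (act l^-1%g r) h * Φ r l.
Proof.
by move=> hr; have [_ _ _ hc _] := qd_proof d; apply: hc; rewrite ?inE.
Qed.
Let ΦJ r s h : r \in N -> Φ (s * r * s^-1)%g h = Φ r h.
Proof.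
by move=> hr; have [_ _ _ _ hJ] := qd_proof d; symmetry; apply: hJ; rewrite ?inE.
Qed.
Let Φ0 r h : r \in N -> Φ r h != 0.
Proof. by move=> hr; have [_ h0 _ _ _] := qd_proof d; apply: h0; rewrite ?inE. Qed.

Let Φ1g h : Φ 1%g h = 1.
Proof.
have n1 := nsg1 N; apply: (mulfI (Φ0 h n1)).
by rewrite -ΦM // mulg1 mulr1.
Qed.
Let Φg1 r : r \in N -> Φ r 1%g = 1.
Proof.
move=> hr; apply: (mulfI (Φ0 1%g hr)).
by rewrite -{1}(aut_act1 act r) -{1}invg1 -Φc // mulg1 mulr1.
Qed.

Definition qdot (h : H) (x : quotGroup N) : quotGroup N := u (act h (j x)).

Lemma qdotE h r : qdot h (u r) = u (act h r).
Proof.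
apply/eqP; rewrite canproj_eq -aut_actV -aut_actMr; apply: stable.
by rewrite -canproj_eq qsecK.
Qed.

Let dot1 x : qdot 1%g x = x.
Proof. by rewrite /qdot aut_act1 qsecK. Qed.
Let dotM h l x : qdot (h * l)%g x = qdot h (qdot l x).
Proof. by rewrite {1 3}/qdot qdotE -aut_actM. Qed.
Let dotMr h x y : qdot h (x * y)%g = (qdot h x * qdot h y)%g.
Proof. by rewrite -[x](qsecK j) -[y](qsecK j) -canprojM !qdotE aut_actMr canprojM. Qed.

Definition crossed_sg x y h := Φ (j x * j y * (j (x * y))^-1)%g h.
Definition crossed_ta l x h :=
  Φ (act l^-1 (j x) * (j (qdot l^-1 x))^-1)%g (l^-1 * h)%g.
Definition crossed_th x h :=
  Φ ((j (qdot h^-1 x^-1))^-1 * act h^-1 (j x)^-1)%g h^-1%g.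

Let mbE x h y h' :
  (x * y)%g # (δ h * δ h' * Φ (j x * j y * (j (x * y))^-1)%g) =
  if h == h' then crossed_sg x y h *: << ((x * y)%g, h) >> else 0.
Proof.
rewrite diracM diracE -scalerAl /crossed_elt (linearZf _ _ (sharp_linear _)).
rewrite sharp_diracl; case: eqVneq => [->|n1]; last by rewrite scale0r.
by rewrite scale1r.
Qed.

Let cbE x h : (let r := j x in \sum_l
    (u r # δ l^-1%g) ⊗
    (u (act l r) # (δ (l * h)%g * Φ (act l (j (u r)) * (j (u (act l r)))^-1)%g))) =
  \sum_l crossed_ta l x h *:
    ((<< (x, l) >> : C) ⊗ (<< (qdot l^-1 x, l^-1 * h)%g >> : C)).
Proof.
rewrite /= [LHS](reindex_inj invg_inj) /=; apply: eq_bigr => l _.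
rewrite /crossed_elt sharp_diracl sharp_dirac invgK qsecK.
by rewrite (linearZf _ _ ((@tpure_bilinear k C C).2 _)).
Qed.

Let qdotV h x : qdot h x^-1%g = u (act h (j x)^-1%g).
Proof. by rewrite -{1}[x](qsecK j) -canprojV qdotE. Qed.

Let sbE x h : (let r := j x in
    u (act h^-1 r^-1)%g #
      (Φ ((j (u (act h^-1 r^-1)))^-1 * act h^-1 (j (u r))^-1)%g * δ h^-1%g)) =
  crossed_th x h *: << (qdot h^-1 x^-1, h^-1)%g >>.
Proof.
rewrite /= /crossed_elt (mulrC _ (δ _)) sharp_diracl /crossed_th qdotV.
by rewrite qsecK.
Qed.

Let oneE : crossed_one = @bone k H (quotGroup N).
Proof.
rewrite /crossed_one /crossed_elt funAlg1E (linear_sumf _ _ (sharp_linear _)).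
by apply: eq_bigr => h _; rewrite sharp_dirac.
Qed.

(* Membership in [N] is checked in the quotient group. *)
Let projE := (memN_proj, canprojM, canprojV, qsecK j).
Let act_proj h x : u (act h (j x)) = qdot h x. Proof. by []. Qed.

Let memsg x y : (j x * j y * (j (x * y))^-1)%g \in N.
Proof. by rewrite !projE mulgV. Qed.
Let memta l x : (act l (j x) * (j (qdot l x))^-1)%g \in N.
Proof. by rewrite !projE act_proj mulgV. Qed.
Let memth l x : ((j (qdot l x^-1))^-1 * act l (j x)^-1)%g \in N.
Proof. by rewrite !projE -qdotV mulVg. Qed.

Lemma crossed_sgA x y z h :
  crossed_sg x y h * crossed_sg (x * y)%g z h =
  crossed_sg y z h * crossed_sg x (y * z)%g h.
Proof.
rewrite /crossed_sg -(ΦM _ (memsg x y) (memsg _ _)).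
rewrite -(ΦJ (j x) h (memsg y z)).
rewrite -(ΦM _ (nsg_normal (j x) (memsg y z)) (memsg _ _)).
by rewrite !mulgA !mulgVK.
Qed.
Lemma crossed_sg1x x h : crossed_sg 1%g x h = 1.
Proof. by rewrite /crossed_sg qsec1 !mul1g mulgV Φ1g. Qed.
Lemma crossed_sgx1 x h : crossed_sg x 1%g h = 1.
Proof. by rewrite /crossed_sg qsec1 !mulg1 mulgV Φ1g. Qed.
Lemma crossed_sg_1 x y : crossed_sg x y 1%g = 1.
Proof. exact: Φg1. Qed.
Lemma crossed_taA l m x h :
  crossed_ta l x h * crossed_ta m x l =
  crossed_ta m x h * crossed_ta (m^-1 * l)%g (qdot m^-1 x) (m^-1 * h)%g.
Proof.
rewrite /crossed_ta.
have -> : (m^-1 * h)%g = ((m^-1 * l) * (l^-1 * h))%g by rewrite mulgA mulgK.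
rewrite (Φc (m^-1 * l)%g (l^-1 * h)%g (memta m^-1%g x)) mulrAC; congr (_ * _).
rewrite mulKg -dotM invgM invgK mulgK.
have e1 := stable (l^-1 * m)%g (memta m^-1%g x).
have e2 := memta (l^-1 * m)%g (qdot m^-1 x); rewrite -dotM mulgK in e2.
rewrite -(ΦM _ e1 e2) aut_actMr aut_actV -aut_actM mulgK.
by rewrite !mulgA mulgVK.
Qed.
Lemma crossed_ta_1 x h : crossed_ta 1%g x h = 1.
Proof. by rewrite /crossed_ta invg1 dot1 aut_act1 mulgV Φ1g. Qed.
Lemma crossed_ta_h x h : crossed_ta h x h = 1.
Proof. by rewrite /crossed_ta mulVg Φg1 ?memta. Qed.
Let qdot1g h : qdot h 1%g = 1%g.
Proof. by rewrite /qdot qsec1 aut_act1g. Qed.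
Lemma crossed_ta1 l h : crossed_ta l 1%g h = 1.
Proof. by rewrite /crossed_ta qdot1g qsec1 aut_act1g mulgV Φ1g. Qed.
Lemma crossed_taM l x y h : crossed_sg x y h * crossed_ta l (x * y)%g h =
  crossed_ta l x h * crossed_ta l y h *
  (crossed_sg x y l * crossed_sg (qdot l^-1 x) (qdot l^-1 y) (l^-1 * h)%g).
Proof.
rewrite /crossed_sg /crossed_ta dotMr.
rewrite -{1}(mulKVg l h) (Φc _ _ (memsg x y)).
rewrite mulrAC [RHS]mulrCA mulrC; congr (_ * _).
set a' := j (qdot l^-1 x); set b' := j (qdot l^-1 y).
have e1 := memta l^-1%g (x * y)%g; rewrite dotMr in e1.
have e2 := memsg (qdot l^-1 x) (qdot l^-1 y).
rewrite -(ΦM _ (stable _ (memsg x y)) e1).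
rewrite -(ΦJ a' _ (memta l^-1%g y)) -mulrA.
rewrite -(ΦM _ (nsg_normal a' (memta l^-1%g y)) e2) -ΦM ?memta //; last first.
  by apply: nsgM => //; apply/nsg_normal/memta.
congr (Φ _ _).
by rewrite !aut_actMr aut_actV !mulgA !mulgVK.
Qed.
Lemma crossed_thl x l : crossed_ta l x 1%g * crossed_th x l *
  crossed_sg (qdot l^-1%g x^-1%g) (qdot l^-1%g x) l^-1%g = 1.
Proof.
rewrite /crossed_ta /crossed_th /crossed_sg mulg1.
rewrite -(ΦJ (j (qdot l^-1%g x^-1%g)) _ (memth _ _)).
have -> : (qdot l^-1 x^-1 * qdot l^-1 x)%g = 1%g by rewrite -dotMr mulVg qdot1g.
set a := act _ (j x); set a' := j (qdot _ x); set b := j (qdot _ x^-1%g).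
have n1 : (a * a'^-1)%g \in N by apply: memta.
have n2 : (b * (b^-1 * a^-1) * b^-1)%g \in N.
  by apply: nsg_normal; rewrite /a -aut_actV; apply: memth.
have n3 : (b * a')%g \in N.
  by have := memsg (qdot l^-1%g x^-1%g) (qdot l^-1%g x);
     rewrite -dotMr mulVg qdot1g qsec1 invg1 mulg1.
rewrite qsec1 invg1 mulg1 aut_actV -(ΦJ a'^-1%g _ n1) mulrC.
have n1' := nsg_normal a'^-1%g n1.
rewrite -ΦM // -ΦM //; last exact: nsgM.
rewrite invgK -[RHS](Φ1g l^-1%g); congr (Φ _ _).
by rewrite -/a !mulgA !(mulgK, mulgVK) mulgV.
Qed.
Lemma crossed_thr x l : crossed_ta l x 1%g * crossed_th (qdot l^-1%g x) l^-1%g *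
  crossed_sg x x^-1%g l = 1.
Proof.
rewrite /crossed_ta /crossed_th /crossed_sg mulg1.
have n1 := memta l^-1%g x.
have := Φc l^-1%g l n1; rewrite mulVg Φg1 // invgK => e1.
have n2 := memth l (qdot l^-1%g x).
have xE : qdot l (qdot l^-1%g x)^-1%g = x^-1%g.
  apply: (@mulIg _ (qdot l (qdot l^-1%g x))).
  by rewrite -dotMr mulVg qdot1g -dotM mulgV dot1 mulVg.
have n3 := memsg x x^-1%g.
rewrite xE in n2.
rewrite xE e1 mulrC mulrCA mulrC -(ΦM _ n3 n2); congr (_ * _).
congr (Φ _ _).
by rewrite mulgV qsec1 invg1 mulg1 aut_actMr -aut_actM mulgV aut_act1 mulgA mulgK.
Qed.

Fact crossed_mulA : associative crossed_mul.
Proof.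
by apply: (bmulA (sg := crossed_sg)) => *; [apply: mbE|apply: crossed_sgA].
Qed.
Fact crossed_mul1 : left_id crossed_one crossed_mul.
Proof.
rewrite oneE; apply: (bmul1 (sg := crossed_sg)) => *; first exact: mbE.
exact: crossed_sg1x.
Qed.
Fact crossed_1mul : right_id crossed_one crossed_mul.
Proof.
rewrite oneE; apply: (b1mul (sg := crossed_sg)) => *; first exact: mbE.
exact: crossed_sgx1.
Qed.
Fact crossed_mulDl : left_distributive crossed_mul +%R.
Proof. exact: bmulDl. Qed.
Fact crossed_mulDr : right_distributive crossed_mul +%R.
Proof. exact: bmulDr. Qed.
Fact crossed_one_neq0 : crossed_one != 0.
Proof. by rewrite oneE bone_neq0. Qed.

HB.instance Definition _ := GRing.Zmodule_isNzRing.Build C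
  crossed_mulA crossed_mul1 crossed_1mul crossed_mulDl crossed_mulDr
  crossed_one_neq0.

Fact crossed_scalerAl (c : k) (a b : C) : c *: (a * b) = (c *: a) * b.
Proof. exact: bscalerAl. Qed.

HB.instance Definition _ := GRing.Lmodule_isLalgebra.Build k C crossed_scalerAl.

Fact crossed_scalerAr (c : k) (a b : C) : c *: (a * b) = a * (c *: b).
Proof. exact: bscalerAr. Qed.

HB.instance Definition _ := GRing.Lalgebra_isAlgebra.Build k C crossed_scalerAr.

Fact crossed_comul_linear : linear crossed_comul.
Proof. exact: bcomul_linear. Qed.
Fact crossed_counit_scalar : scalar crossed_counit.
Proof. exact: bcounit_scalar. Qed.
Fact crossed_antipode_linear : linear crossed_antipode.
Proof. exact: bantipode_linear. Qed.

Fact crossed_comulA (a : C) :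
  tassoc (tmap crossed_comul idfun (crossed_comul a)) =
  tmap idfun crossed_comul (crossed_comul a).
Proof.
apply: (bcomulA (ta := crossed_ta) (dot := qdot)) => *.
- exact: dotM.
- exact: cbE.
- exact: crossed_taA.
Qed.
Fact crossed_comul_counitl (a : C) :
  tlift (fun x y => crossed_counit x *: y) (crossed_comul a) = a.
Proof.
apply: (bcomul_counitl (ta := crossed_ta) (dot := qdot)) => *.
- exact: dot1.
- exact: cbE.
- exact: crossed_ta_1.
Qed.
Fact crossed_comul_counitr (a : C) :
  tlift (fun x y => crossed_counit y *: x) (crossed_comul a) = a.
Proof.
apply: (bcomul_counitr (ta := crossed_ta) (dot := qdot)) => *.
- exact: cbE.
- exact: crossed_ta_h.
Qed.
Fact crossed_comul1 : crossed_comul 1 = 1 ⊗ 1.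
Proof.
rewrite -[1]/crossed_one oneE.
apply: (bcomul1 (ta := crossed_ta) (dot := qdot)) => *.
- exact: dotMr.
- exact: cbE.
- exact: crossed_ta1.
Qed.
Fact crossed_comulM (a b : C) :
  crossed_comul (a * b) = tmul (crossed_comul a) (crossed_comul b).
Proof.
apply: (bcomulM (sg := crossed_sg) (ta := crossed_ta) (dot := qdot)) => *.
- exact: dotMr.
- exact: mbE.
- exact: cbE.
- exact: crossed_taM.
Qed.
Fact crossed_counit1 : crossed_counit 1 = 1.
Proof. by rewrite -[1]/crossed_one oneE; apply: bcounit1. Qed.
Fact crossed_counitM : {morph crossed_counit : a b / a * b}.
Proof.
apply: (bcounitM (sg := crossed_sg)) => *; first exact: mbE.
exact: crossed_sg_1.
Qed.
Fact crossed_antipodel (a : C) :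
  tlift (fun x y => crossed_antipode x * y) (crossed_comul a) =
  (crossed_counit a)%:A.
Proof.
rewrite -[1]/crossed_one oneE.
apply: (bantipodel (sg := crossed_sg) (ta := crossed_ta) (th := crossed_th)
  (dot := qdot)) => *.
- exact: dotMr.
- exact: mbE.
- exact: cbE.
- exact: sbE.
- exact: crossed_thl.
Qed.
Fact crossed_antipoder (a : C) :
  tlift (fun x y => x * crossed_antipode y) (crossed_comul a) =
  (crossed_counit a)%:A.
Proof.
rewrite -[1]/crossed_one oneE.
apply: (bantipoder (sg := crossed_sg) (ta := crossed_ta) (th := crossed_th)
  (dot := qdot)) => *.
- exact: dot1.
- exact: dotM.
- exact: dotMr.
- exact: mbE.
- exact: cbE.
- exact: sbE.
- exact: crossed_thr.
Qed.

HB.instance Definition _ := Algebra_isHopf.Build k C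
  crossed_comul_linear crossed_counit_scalar crossed_antipode_linear
  crossed_comulA crossed_comul_counitl crossed_comul_counitr
  crossed_comul1 crossed_comulM crossed_counit1 crossed_counitM
  crossed_antipodel crossed_antipoder.

Lemma crossed_eltM r s h h' : (u r # δ h) * (u s # δ h') =
  u (r * s)%g # (δ h * δ h' * Φ (j (u r) * j (u s) * (j (u (r * s)))^-1)%g).
Proof.
rewrite {1 2}/crossed_elt !sharp_dirac; apply: etrans (bmulU _ _ _) _ => /=.
by rewrite -canprojM.
Qed.

Lemma crossed_comulE r h : comul (u r # δ h) =
  \sum_l (u r # δ l^-1%g) ⊗
    (u (act l r) # (δ (l * h)%g * Φ (act l (j (u r)) * (j (u (act l r)))^-1)%g)).
Proof.
rewrite {1}/crossed_elt sharp_dirac; apply: etrans (mlinU _ _) _ => /=.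
by apply: eq_bigr => l _; rewrite qsecK -[u (act l (j (u r)))]/(qdot l (u r)) qdotE.
Qed.

Lemma crossed_counitE r h : counit (u r # δ h) = (h == 1%g)%:R.
Proof. by rewrite /crossed_elt sharp_dirac; apply: bcounitE. Qed.

Lemma crossed_antipodeE r h : antipode (u r # δ h) =
  u (act h^-1 r^-1)%g #
    (Φ ((j (u (act h^-1 r^-1)))^-1 * act h^-1 (j (u r))^-1)%g * δ h^-1%g).
Proof.
rewrite {1}/crossed_elt sharp_dirac; apply: etrans (mlinU _ _) _ => /=.
by rewrite -qdotV qsecK -canprojV qdotE.
Qed.

End Crossed.

Section MaximalData.
Variables (k : fieldType) (H : finGroupType) (Gam : groupType).
Variables (act : autAction H Gam) (R : algType k).
Variables (rho : {lrmorphism smash k act -> R}).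
Implicit Types d : quotDatum k act.

(* [qd_compatible] is membership in [E(rho)]. As [qd_fun] is irrelevant outside
   [qd_sub], equality in [E(rho)] is [qd_le] both ways, not Leibniz equality. *)
Definition qd_compatible d : Prop := {in qd_sub d, forall r,
  rho (smash_elt act r 1) = rho (smash_elt act 1%g (qd_fun d r))}.

Definition qd_le d d' : Prop := {subset qd_sub d <= qd_sub d'} /\
  {in qd_sub d, forall r, qd_fun d' r = qd_fun d r}.

Definition qd_maximal d : Prop :=
  qd_compatible d /\ forall d', qd_compatible d' -> qd_le d d' -> qd_le d' d.

Definition datum_factorization d (j : quotSection (qd_sub d))
    (q : {lrmorphism smash k act -> crossed j})
    (rho' : {lrmorphism crossed j -> R}) : Prop :=
  [/\ hopf_factorization rho q rho',
      forall r h, let x := canproj (qd_sub d) r in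
        q (smash_elt act r (dirac k h)) =
        crossed_elt j x (dirac k h * qd_fun d (r * (j x)^-1)%g) &
      forall r h, let x := canproj (qd_sub d) r in
        rho' (crossed_elt j x (dirac k h)) =
        rho (smash_elt act (j x) (dirac k h))].

End MaximalData.

(* Main.v *)
Require Import Defs.
From HB Require Import structures.
From mathcomp Require Import boolp classical_sets.
From mathcomp Require Import all_boot all_order all_algebra fingroup.
From mathcomp Require Import finmap monalg.

Set Implicit Arguments.
Unset Strict Implicit.
Unset Printing Implicit Defensive.

Import GRing.Theory.
Local Open Scope ring_scope.

(** Write [r # f] for the elements of the smash coproduct A, write [u] for the
projection from Γ to Γ/N, and let [δ h] be the Dirac function at [h].

Part (a) is a computation.  The formula for [q] defines a Hopf algebra map for
every quotient datum, because the multiplicativity, conjugation invariance and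
cocycle property of Φ are exactly what turns the defects of the section [j]
into the structure constants of the crossed algebra ([crossed_proj_monoid],
[crossed_proj_hopf]).  Compatibility of the datum with [rho] makes
[rho (r # f)] depend on [q (r # f)] alone ([crossed_descK]); as [q] is onto,
the multiplicativity of the induced map is inherited from [rho].

For part (b), E(rho) even has a greatest element.  If (N, Φ) is in E(rho), [r]
is in N and [f] is Φ(r), then the cocycle property determines Φ on the whole
H-orbit of [r] by [f], and compatibility reads
  [f l *: rho (act l^-1 r # 1) = rho (1 # f (l * _))]  for all [l].
This condition ([acts_as]) speaks of [r] and [f] alone and mentions no datum.
Its solutions are stable under products, inverses, conjugation and the action
of H.  Given [r] there is at most one solution [f] ([acts_as_inj]): the points
of H at which all pairs of solutions agree form a subgroup, and [rho] vanishes
on the Dirac functions outside of it, so that by inner faithfulness of [rho] on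
k^H this subgroup is H ([support_inner_faithful]).  Hence the [r] for which
there is a solution form the greatest datum, and every maximal datum agrees
with it.

For part (c), let rho = phi p with p : A -> L a surjective Hopf algebra map.
It suffices that ker p is contained in ker q.  Put e r h = p (r # δ h).
- No e 1 h vanishes: the [h] with e 1 h nonzero form a subgroup, to which
  [support_inner_faithful] applies ([image_dirac_neq0]).
- Comultiplying and keeping the component at [l] gives linear maps sending
  e r h to e r l ⊗ e (l^-1.r) (l^-1 h) ([cosliceE]).  For l = h = 1 this says
  that the e r 1 are group-like for the component at 1, so distinct ones are
  independent even with coefficients in another tensor factor ([grouplike_tensor_free]).  For l = 1
  it follows that a relation between the e r h, for fixed [h], splits according
  to the value of e r 1 ([sliced_fiber]).
- If e r 1 = e 1 1, comparing the components of e r 1 and e 1 1 shows that e r l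
  is a multiple f(l) of e 1 l, and [f] satisfies the condition displayed above
  for p, hence for [rho] ([sliced_cocycle], [image_acts_as]).  Thus [r] lies in
  the greatest datum and [q] identifies [r # 1] with [1 # f] as p does.
So in each part of a relation all terms are proportional, with the same
coefficients for p and for [q], and ker p is contained in ker q
([kernel_contained]). *)

(** * Linear functionals and tensors *)

Lemma sum_fibers (V : nmodType) (I K : eqType) (s : seq I) (key : I -> K)
    (F : I -> V) :
  \sum_(i <- s) F i =
  \sum_(g <- undup (map key s)) \sum_(i <- s | key i == g) F i.
Proof.
under [RHS]eq_bigr => g _ do rewrite big_mkcond.
rewrite exchange_big /= big_seq [RHS]big_seq; apply: eq_bigr => i si.
rewrite -big_mkcond /= (big_rem (key i)) /= ?mem_undup ?map_f // eqxx.
rewrite big_seq_cond big_pred0 ?addr0 // => g.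
by rewrite mem_rem_uniq ?undup_uniq // !inE eq_sym andbAC andNb.
Qed.

Section Functionals.
Variable k : fieldType.

Lemma scalerMM (R : algType k) (a b : k) (x y : R) :
  (a * b) *: (x * y) = (a *: x) * (b *: y).
Proof. by rewrite -scalerAl -scalerAr scalerA. Qed.

(** A subspace maximal among those that avoid [v] is a complement of the line
through [v]; the functional is the coordinate along that line. *)
Lemma exists_functional (V : lmodType k) (v : V) : v != 0 ->
  exists2 phi : V -> k, scalar phi & phi v = 1.
Proof.
move=> v0.
pose P (W : classical_sets.set V) :=
  (forall a x y, W x -> W y -> W (a *: x + y)) /\ ~ W v.
(* [P] leaves out [W 0] so that the union of the empty chain satisfies it. *)
have [F FP Ftot|W [[Wlin Wv] Wmax]] := @Zorn_bigcup V P.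
  split=> [a x y [X FX Xx] [Y FY Yy]|[X FX Xv]]; last by have [] := FP X FX.
  have [XY|YX] := Ftot X Y FX FY.
    by exists Y => //; apply: (FP Y FY).1 => //; apply: XY.
  by exists X => //; apply: (FP X FX).1 => //; apply: YX.
have W0 : W 0.
  apply: contrapT => nW0.
  have Wempty x : ~ W x.
    by move=> Wx; apply: nW0; rewrite -(addNr x) -scaleN1r; apply: Wlin.
  apply: (Wmax [set 0]%classic); last first.
    split=> [a x y -> ->|]; first by rewrite scaler0 addr0.
    by move=> /= e; rewrite e eqxx in v0.
  by split=> [x /Wempty //|/(_ 0 erefl)/nW0].
have coef x : exists c, W (x - c *: v).
  have [Wx|nWx] := pselect (W x).
    by exists 0; rewrite scale0r subr0.
  apply: contrapT => nc.
  pose B := (fun y => exists2 c, W (y - c *: x) & True) : classical_sets.set V.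
  apply: (Wmax B).
    split=> [y Wy|/(_ x) h]; first by exists 0 => //; rewrite scale0r subr0.
    by apply: nWx; apply: h; exists 1 => //; rewrite scale1r subrr.
  split=> [a y z [c Wy _] [d Wz _]|[c Wc _]].
    exists (a * c + d) => //.
    rewrite scalerDl -scalerA opprD addrACA -scalerBr; exact: Wlin.
  have [c0|nz] := eqVneq c 0; first by rewrite c0 scale0r subr0 in Wc.
  apply: nc; exists c^-1.
  have := Wlin (- c^-1) _ _ Wc W0.
  by rewrite addr0 scaleNr scalerBr scalerA mulVf // scale1r opprB.
have [phi phiP] := choice coef; have coef_uniq x c : W (x - c *: v) -> phi x = c.
  move=> Wc; apply/eqP; rewrite -subr_eq0; apply/negPn/negP => nz; apply: Wv.
  have := Wlin (- (phi x - c)^-1) _ _ (Wlin (-1) _ _ Wc (phiP x)) W0.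
  rewrite addr0 scaleN1r opprB subrKA -scalerBl scalerA mulNr -mulrN opprB.
  by rewrite mulVf // scale1r.
exists phi => [a x y|]; apply: coef_uniq.
  rewrite scalerDl -scalerA opprD addrACA -scalerBr; exact: Wlin.
by rewrite scale1r subrr.
Qed.

Lemma tpure_linearl (V W : lmodType k) (w : W) : linear (fun v : V => v ⊗ w).
Proof. exact: (@tpure_bilinear k V W).1. Qed.

Lemma tpure_linearr (V W : lmodType k) (v : V) : linear (fun w : W => v ⊗ w).
Proof. exact: (@tpure_bilinear k V W).2. Qed.

Lemma tpure_scale_eq (V W : lmodType k) (a b c d : k)
    (v : V) (w : W) :
  a * b = c * d -> a *: (v ⊗ (b *: w)) = (c *: v) ⊗ (d *: w).
Proof.
move=> e; rewrite (linearZf _ _ (tpure_linearl _)) !(linearZf _ _ (tpure_linearr _)).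
by rewrite !scalerA e.
Qed.

Lemma tpure_sumr (V W : lmodType k) (v : V) (I : Type)
    (s : seq I) (P : pred I) (w : I -> W) :
  v ⊗ (\sum_(i <- s | P i) w i) = \sum_(i <- s | P i) v ⊗ w i.
Proof. by rewrite -big_filter (linear_sumf _ _ (tpure_linearr v)) big_filter. Qed.

Lemma contract_pure (V W : lmodType k) (phi : V -> k) v (w : W) :
  scalar phi -> tlift (fun x y => phi x *: y) (v ⊗ w) = phi v *: w.
Proof. by move=> hphi; rewrite tlift_pure //; apply: bilinear_scale_flip. Qed.

Lemma contract_linear (V W : lmodType k) (phi : V -> k) :
  scalar phi -> linear (tlift (fun (x : V) (y : W) => phi x *: y)).
Proof. by move=> hphi; apply/tlift_linear/bilinear_scale_flip. Qed.

Lemma tpure_eq0 (V W : lmodType k) (v : V) (w : W) :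
  v ⊗ w = 0 -> v != 0 -> w = 0.
Proof.
move=> vw0 /exists_functional[phi hphi phiv].
rewrite -[w]scale1r -phiv -(contract_pure _ _ hphi) vw0.
exact: (linear0f (contract_linear hphi)).
Qed.

(** Contract the second factor with a functional that is 1 at [w']. *)
Lemma tpure_proportional (V W : lmodType k) (v v' : V) (w w' : W) :
  v ⊗ w = v' ⊗ w' -> v' != 0 -> w' != 0 -> exists2 c, c != 0 & v = c *: v'.
Proof.
move=> e v'0 /exists_functional[phi hphi phi1].
have pure x y : tlift (fun (a : V) (b : W) => phi b *: a) (x ⊗ y) = phi y *: x.
  by rewrite tlift_pure //; apply/bilinear_flip/bilinear_scale_flip.
have vE : phi w *: v = v' by rewrite -pure e pure phi1 scale1r.
have pw0 : phi w != 0 by apply: contraNneq v'0 => p0; rewrite -vE p0 scale0r.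
by exists (phi w)^-1; rewrite ?invr_eq0 // -vE scalerK.
Qed.

(** Independence of group-like elements with coefficients in [W].  A functional
[phi] applied to the first leg of [D] multiplies the coefficient of each
group-like [g] by [phi g]; subtracting [phi g] times the relation removes the
term of the head [g], and a [phi] separating [x] from [g] keeps that of [x]. *)
Lemma grouplike_tensor_free (V W : lmodType k) (D : V -> tensor V V) (s : seq V)
    (y : V -> W) :
  linear D -> uniq s -> {in s, forall g, g != 0 /\ D g = g ⊗ g} ->
  \sum_(g <- s) g ⊗ y g = 0 -> {in s, forall g, y g = 0}.
Proof.
move=> Dlin; elim: s y => [//|g s IH] y /= /andP[gs us] Dg sum0.
have sgl : {in s, forall x, x != 0 /\ D x = x ⊗ x}.
  by move=> x xs; apply: Dg; rewrite inE xs orbT.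
have ys : {in s, forall x, y x = 0}.
  move=> x xs; have /exists_functional[phi hphi phi1] : x - g != 0.
    by rewrite subr_eq0; apply: contraNneq gs => <-.
  have phil : linear (phi : V -> k^o) by [].
  pose cD (v : V) := tlift (fun a b : V => phi a *: b) (D v).
  have cDl : linear cD by apply: linear_comp_fun => //; apply: contract_linear.
  have cDE z : z \in g :: s -> cD z = phi z *: z.
    by move=> /Dg[_ e]; rewrite /cD e contract_pure.
  pose T (t : tensor V W) := tlift (fun a b => (cD a - phi g *: a) ⊗ b) t.
  have Tb : bilinear_map (fun a (b : W) => (cD a - phi g *: a) ⊗ b).
    apply: (bilinear_comp (g := fun a => cD a - phi g *: a) (h := idfun)
      (@tpure_bilinear _ _ _)) => // a v w.
    rewrite cDl scalerDr opprD addrACA scalerBr; congr (_ - _ + _).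
    by rewrite !scalerA mulrC.
  have Tl : linear T by apply: tlift_linear.
  have sum1 : \sum_(z <- s) z ⊗ ((phi z - phi g) *: y z) = 0.
    transitivity (T 0); last exact: linear0f Tl.
    rewrite -{2}sum0 (linear_sumf _ _ Tl) big_cons /T tlift_pure //.
    rewrite cDE ?mem_head // subrr.
    rewrite (linear0f (tpure_linearl _)) add0r.
    rewrite !big_seq; apply: eq_bigr => z zs.
    rewrite tlift_pure // cDE ?inE ?zs ?orbT // -scalerBl.
    rewrite (linearZf _ _ (tpure_linearl _)).
    by rewrite (linearZf _ _ (tpure_linearr _)).
  have := IH _ us sgl sum1 x xs.
  have phix : phi x - phi g = 1.
    by rewrite -phi1 -scaleN1r addrC [in RHS]addrC hphi mulN1r.
  by rewrite phix scale1r.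
have yg : y g = 0.
  apply: (@tpure_eq0 _ _ g); last by have [] := Dg g (mem_head _ _).
  rewrite -[RHS]sum0 big_cons big_seq big1 ?addr0 // => x xs.
  by rewrite ys // (linear0f (tpure_linearr _)).
by move=> x /[!inE]/predU1P[->//|/ys].
Qed.

End Functionals.

(** * Inner faithful maps on the functions on a finite group *)

Section Restriction.
Variables (k : fieldType) (H : finGroupType) (G : {group H}).
Local Notation kH := (funAlg k H).
Local Notation kG := (funAlg k (subg_of G)).

Definition fun_restr (f : kH) : kG := [ffun g => f (sgval g)].
(** Extension by zero; a section of the restriction, and multiplicative without
being unital. *)
Definition fun_extend (f : kG) : kH :=
  [ffun h => if h \in G then f (subg G h) else 0].

Fact fun_restr_linear : linear fun_restr.
Proof. by move=> c f g; apply/ffunP => x; rewrite !ffunE. Qed.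
Fact fun_restr_monoid : monoid_morphism fun_restr.
Proof. by split=> [|f g]; apply/ffunP => x; rewrite !ffunE. Qed.

HB.instance Definition _ := GRing.isLinear.Build k kH kG _
  fun_restr fun_restr_linear.
HB.instance Definition _ := GRing.isMonoidMorphism.Build kH kG
  fun_restr fun_restr_monoid.

Lemma fun_extendK : cancel fun_extend fun_restr.
Proof. by move=> f; apply/ffunP => x; rewrite !ffunE subgP sgvalK. Qed.

Lemma fun_restr_dirac h : fun_restr (dirac k h) =
  if h \in G then dirac k (subg G h) else 0.
Proof.
apply/ffunP => x; rewrite !ffunE; case: ifP => hG; rewrite !ffunE.
  by rewrite -(inj_eq val_inj) /= subgK.
by case: eqP => // e; rewrite -e subgP in hG.
Qed.

Lemma sum_subg (V : nmodType) (F : H -> V) :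
  \sum_(h in G) F h = \sum_(g : subg_of G) F (sgval g).
Proof.
rewrite (reindex_onto (@sgval H G) (subg G)) /=; last by move=> h /subgK.
by apply: eq_bigl => g; rewrite subgP sgvalK eqxx.
Qed.

Lemma fun_restr_hopf : hopf_map fun_restr.
Proof.
split=> f; last by rewrite [LHS]ffunE.
have tl : linear (tmap fun_restr fun_restr) by apply: tmap_linear; apply: fun_restr_linear.
rewrite [RHS](linear_sumf _ _ tl) [comul _]/(fcomul _) /fcomul.
under [RHS]eq_bigr => h _ do rewrite (linear_sumf _ _ tl).
pose F h l := f (h * l)%g *: (fun_restr (dirac k h) ⊗ fun_restr (dirac k l)).
transitivity (\sum_h \sum_l F h l); last first.
  apply: eq_bigr => h _; apply: eq_bigr => l _.
  by rewrite (linearZf _ _ tl) tmap_pure //; apply: fun_restr_linear.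
rewrite [RHS](bigID (mem G)) /= [X in _ + X]big1 ?addr0; last first.
  move=> h nh; rewrite big1 // => l _.
  by rewrite /F fun_restr_dirac (negPf nh) (linear0f (tpure_linearl _)) scaler0.
rewrite sum_subg; apply: eq_bigr => g _.
rewrite [RHS](bigID (mem G)) /= [X in _ + X]big1 ?addr0; last first.
  move=> l nl.
  by rewrite /F [fun_restr (dirac k l)]fun_restr_dirac (negPf nl)
    (linear0f (tpure_linearr _)) scaler0.
rewrite sum_subg; apply: eq_bigr => l _.
by rewrite /F !fun_restr_dirac !subgP !sgvalK ffunE.
Qed.

(** Such a [sigma] factors through the restriction of functions to [G], so the
universal property of inner faithfulness makes this restriction injective. *)
Lemma support_inner_faithful (R : algType k) (sigma : {lrmorphism kH -> R}) :
  inner_faithful sigma -> (forall h, h \notin G -> sigma (dirac k h) = 0) ->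
  forall h, h \in G.
Proof.
move=> [_ univ] sigma0 h.
have killed (f : kH) : (forall h, h \in G -> f h = 0) -> sigma f = 0.
  move=> f0; rewrite [f]funAlg_span linear_sum big1 // => l _.
  rewrite linearZ /=; have [lG|/sigma0->] := boolP (l \in G); last exact: scaler0.
  by rewrite f0 // scale0r.
have restrE (f : kH) : sigma (fun_extend (fun_restr f)) = sigma f.
  apply/eqP; rewrite -subr_eq0 -linearB /=; apply/eqP/killed => l lG.
  by rewrite !ffunE lG subgK // subrr.
pose phi (f : kG) := sigma (fun_extend f).
have phi_lin : linear phi.
  move=> c f g; rewrite -[f]fun_extendK -[g]fun_extendK -linearP /phi !restrE.
  by rewrite linearP.
have phi_mon : GRing.monoid_morphism phi.
  split=> [|f g]; first by rewrite -[1](rmorph1 fun_restr) /phi restrE rmorph1.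
  rewrite -[f]fun_extendK -[g]fun_extendK -rmorphM /phi !restrE.
  by rewrite rmorphM.
pose phiM : {lrmorphism kG -> R} := HB.pack phi
  (GRing.isLinear.Build k kG R _ phi phi_lin)
  (GRing.isMonoidMorphism.Build kG R phi phi_mon).
have fact : hopf_factorization sigma (fun_restr : {lrmorphism kH -> kG}) phiM.
  split=> [|y|f]; first exact: fun_restr_hopf.
    by exists (fun_extend y); apply: fun_extendK.
  by rewrite /= -[RHS]/(sigma _) restrE.
have [f [[_ fK _] _]] := univ _ _ _ fact.
apply/negPn/negP => nh; have := fK (dirac k h); rewrite /= fun_restr_dirac.
rewrite (negPf nh) linear0 => /ffunP/(_ h)/esym/eqP.
by rewrite !ffunE eqxx oner_eq0.
Qed.

End Restriction.

(** * The greatest quotient datum *)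

Section QuotDatumTheory.
Variables (k : fieldType) (H : finGroupType) (Gam : groupType).
Variables (act : autAction H Gam) (d : quotDatum k act).
Local Notation N := (qd_sub d).
Local Notation Φ := (qd_fun d).

Lemma qd_stable r h : r \in N -> act h r \in N.
Proof. by case: (qd_proof d) => st _ _ _ _ rN; apply: st; rewrite ?inE. Qed.

Lemma qd_fun_neq0 r h : r \in N -> Φ r h != 0.
Proof. by case: (qd_proof d) => _ n0 _ _ _ rN; apply: n0; rewrite ?inE. Qed.

Lemma qd_funM r s : r \in N -> s \in N -> Φ (r * s)%g = Φ r * Φ s.
Proof.
case: (qd_proof d) => _ _ hM _ _ rN sN; apply/ffunP => h.
by rewrite ffunE; apply: hM; rewrite ?inE.
Qed.

Lemma qd_funJ r s : r \in N -> Φ (s * r * s^-1)%g = Φ r.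
Proof.
case: (qd_proof d) => _ _ _ _ hJ rN; apply/ffunP => h.
by symmetry; apply: hJ; rewrite ?inE.
Qed.

Lemma qd_fun_cocycle r l h : r \in N ->
  Φ r (l * h)%g = Φ (act l^-1%g r) h * Φ r l.
Proof. by case: (qd_proof d) => _ _ _ hc _ rN; apply: hc; rewrite ?inE. Qed.

Lemma qd_fun1 : Φ 1%g = 1.
Proof.
apply/ffunP => h; rewrite [RHS]ffunE.
apply: (mulfI (qd_fun_neq0 h (nsg1 N))).
by rewrite mulr1 -[in RHS](mulg1 1%g) qd_funM ?nsg1 // ffunE.
Qed.

Lemma qd_fun_at1 r : r \in N -> Φ r 1%g = 1.
Proof.
move=> rN; apply: (mulfI (qd_fun_neq0 1%g rN)); rewrite mulr1.
by rewrite -[in RHS](mulg1 1%g) qd_fun_cocycle // invg1 aut_act1.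
Qed.

End QuotDatumTheory.

Section SmashTheory.
Variables (k : fieldType) (H : finGroupType) (Gam : groupType).
Variables (act : autAction H Gam).
Local Notation kH := (funAlg k H).
Local Notation "r # f" := (smash_elt act r f) (at level 37).

Lemma smash_elt_linear r : linear (smash_elt act r : kH -> _).
Proof. exact: sharp_linear. Qed.

Lemma smash_elt_comm r (f : kH) : (1%g # f) * (r # 1) = (r # 1) * (1%g # f).
Proof. by rewrite !smash_eltM mulg1 mul1g mul1r mulr1. Qed.

Lemma smash_elt_dirac r (f : kH) h :
  (r # f) * (1%g # dirac k h) = f h *: (r # dirac k h).
Proof.
by rewrite smash_eltM mulg1 [f * _]mulrC diracM (linearZf _ _ (smash_elt_linear r)).
Qed.

End SmashTheory.

Section GreatestDatum.
Variables (k : fieldType) (H : finGroupType) (Gam : groupType).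
Variables (act : autAction H Gam).
Local Notation kH := (funAlg k H).
Local Notation A := (smash k act).
Local Notation "r # f" := (smash_elt act r f) (at level 37).

Definition ltrans (l : H) (f : kH) : kH := [ffun h => f (l * h)%g].

Lemma ltransM l f g : ltrans l (f * g) = ltrans l f * ltrans l g.
Proof. by apply/ffunP => h; rewrite !ffunE. Qed.

(** The trace of a compatible datum on a single [r], with [f] in the role of
[Φ r].  At [l = 1] the last clause says that [rho (r # 1) = rho (1 # f)]; for
the other [l] it says the same of the translates of [r], since the cocycle
property forces [Φ (act l^-1 r)] to be [(f l)^-1 *: ltrans l f]. *)
Definition acts_as (R : algType k) (rho : A -> R) (r : Gam) (f : kH) : Prop :=
  [/\ f 1%g = 1, forall h, f h != 0 &
      forall l, f l *: rho (act l^-1%g r # 1) = rho (1%g # ltrans l f)].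

Variables (R : algType k) (rho : {lrmorphism A -> R}).

Lemma acts_as_eq r f : acts_as rho r f -> rho (r # 1) = rho (1%g # f).
Proof.
case=> f1 _ /(_ 1%g); rewrite f1 scale1r invg1 aut_act1 => ->.
by congr (rho (_ # _)); apply/ffunP => h; rewrite ffunE mul1g.
Qed.

Lemma acts_as_comp (B : algType k) (p : A -> B) (phi : {lrmorphism B -> R}) r f :
  rho =1 phi \o p -> acts_as p r f -> acts_as rho r f.
Proof.
move=> rhop [f1 f0 fE]; split=> [||l]; [exact: f1|exact: f0|].
rewrite [X in _ *: X]rhop [RHS]rhop /= -[LHS]linearZ /=.
by congr (phi _); apply: fE.
Qed.

Lemma acts_as_datum d r : qd_compatible rho d -> r \in qd_sub d ->
  acts_as rho r (qd_fun d r).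
Proof.
move=> dc rN; split=> [|h|l]; first exact: qd_fun_at1.
  exact: qd_fun_neq0.
rewrite dc ?qd_stable // -linearZ /= -(linearZf _ _ (@smash_elt_linear _ _ _ act 1%g)).
congr (rho (_ # _)); apply/ffunP => h; rewrite !ffunE qd_fun_cocycle //.
exact: mulrC.
Qed.

Lemma acts_as1 : acts_as rho 1%g 1.
Proof.
split=> [|h|l]; rewrite ?ffunE ?oner_eq0 // scale1r aut_act1g.
by congr (rho (_ # _)); apply/ffunP => h; rewrite !ffunE.
Qed.

Lemma acts_asM r s f g :
  acts_as rho r f -> acts_as rho s g -> acts_as rho (r * s)%g (f * g).
Proof.
move=> [f1 f0 fE] [g1 g0 gE]; split=> [|h|l].
- by rewrite ffunE f1 g1 mulr1.
- by rewrite ffunE mulf_neq0 ?f0 ?g0.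
have -> : act l^-1%g (r * s)%g # 1 = (act l^-1%g r # 1) * (act l^-1%g s # 1) :> A.
  by rewrite smash_eltM mulr1 aut_actMr.
have -> : 1%g # ltrans l (f * g) = (1%g # ltrans l f) * (1%g # ltrans l g) :> A.
  by rewrite smash_eltM mulg1 ltransM.
rewrite [X in _ *: X]rmorphM [RHS]rmorphM ffunE scalerMM.
by congr (_ * _); [apply: fE|apply: gE].
Qed.

Lemma acts_asV r f : acts_as rho r f -> acts_as rho r^-1%g [ffun h => (f h)^-1].
Proof.
move=> [f1 f0 fE]; split=> [|h|l]; rewrite ?ffunE ?f1 ?invr1 ?invr_eq0 ?f0 //.
(* Both sides are inverses of the same element of [R], one on each side. *)
set y := _ *: _; set z := RHS.
have xy : (f l *: rho (act l^-1%g r # 1)) * y = 1.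
  rewrite /y -scalerMM mulfV ?f0 // scale1r -[LHS]rmorphM.
  by rewrite smash_eltM mulr1 -aut_actMr mulgV aut_act1g; apply: rmorph1.
have zx : z * (f l *: rho (act l^-1%g r # 1)) = 1.
  rewrite [X in _ * X]fE /z -[LHS]rmorphM smash_eltM mulg1.
  have -> : ltrans l [ffun h => (f h)^-1] * ltrans l f = 1.
    by apply/ffunP => h; rewrite !ffunE mulVf.
  exact: rmorph1.
by rewrite -[LHS]mul1r -zx -mulrA xy mulr1.
Qed.

Lemma acts_asJ r f s : acts_as rho r f -> acts_as rho (s * r * s^-1)%g f.
Proof.
move=> [f1 f0 fE]; split=> [||l]; [exact: f1|exact: f0|].
set t := act l^-1%g s.
have -> : act l^-1%g (s * r * s^-1)%g # 1 =
    (t # 1) * (act l^-1%g r # 1) * (t^-1%g # 1) :> A.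
  by rewrite !smash_eltM !mulr1 !aut_actMr aut_actV.
rewrite !rmorphM scalerAl scalerAr fE -!rmorphM -smash_elt_comm -mulrA.
by rewrite [X in _ * X]smash_eltM mulgV mulr1 mulr1.
Qed.

Lemma acts_as_act r f m :
  acts_as rho r f -> acts_as rho (act m^-1%g r) ((f m)^-1 *: ltrans m f).
Proof.
move=> [f1 f0 fE]; split=> [|h|l].
- by rewrite !ffunE mulg1; apply: mulVf.
- by rewrite !ffunE; apply: mulf_neq0; rewrite ?invr_eq0 f0.
rewrite -aut_actM -invgM !ffunE.
have -> : ltrans l ((f m)^-1 *: ltrans m f) = (f m)^-1 *: ltrans (m * l)%g f.
  by apply/ffunP => h; rewrite !ffunE mulgA.
by rewrite (linearZf _ _ (@smash_elt_linear _ _ _ act 1%g)) linearZ /= -fE scalerA.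
Qed.

Hypothesis rho_inner : inner_faithful (rho \o funAlg_incl act).

(** Agreement at [h] is required of the solutions for every [r] at once: then
the points of agreement are closed under products, as the solutions for [r]
give by translation solutions for [act h^-1 r]. *)
Lemma acts_as_inj r f g : acts_as rho r f -> acts_as rho r g -> f = g.
Proof.
pose P h := forall r f g, acts_as rho r f -> acts_as rho r g -> f h = g h.
pose G := [set h | `[< P h >]].
have gG : group_set G.
  apply/group_setP; split=> [|h l]; rewrite !inE.
    by apply/asboolP => s a b [a1 _ _] [b1 _ _]; rewrite a1 b1.
  move=> /asboolP hh /asboolP hl; apply/asboolP => s a b as_a as_b.
  have := hl _ _ _ (acts_as_act h as_a) (acts_as_act h as_b).
  rewrite !ffunE (hh _ _ _ as_a as_b); apply: mulfI.
  by have [_ b0 _] := as_b; rewrite invr_eq0.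
have inG := support_inner_faithful (G := Group gG) rho_inner.
move=> af ag; apply/ffunP => h; have /inG/(_ h) : forall l, l \notin Group gG ->
    rho (1%g # dirac k l) = 0.
  move=> l; rewrite inE => /asboolPn nP.
  apply: contrapT => nz; apply: nP => s a b as_a as_b.
  have aE t : acts_as rho s t ->
      t l *: rho (1%g # dirac k l) = rho (s # 1) * rho (1%g # dirac k l).
    move=> as_t; rewrite [X in X * _](acts_as_eq as_t) -[RHS]rmorphM.
    by rewrite smash_elt_dirac [RHS]linearZ.
  have /eqP := aE _ as_b; rewrite -(aE _ as_a) -subr_eq0 -scalerBl.
  by rewrite scaler_eq0 subr_eq0 => /orP[/eqP|/eqP].
by rewrite inE => /asboolP hP; apply: hP af ag.
Qed.

Definition greatest_pred : {pred Gam} := fun r => `[< exists f, acts_as rho r f >].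

Lemma greatest_predP r : reflect (exists f, acts_as rho r f) (r \in greatest_pred).
Proof. exact: asboolP. Qed.

Fact greatest_closed : group_closed greatest_pred.
Proof.
split=> [|r s /greatest_predP[f rf] /greatest_predP[g sg]]; apply/greatest_predP.
  by exists 1; apply: acts_as1.
by eexists; apply: acts_asM rf (acts_asV sg).
Qed.

Fact greatest_normal r s : r \in greatest_pred -> (s * r * s^-1)%g \in greatest_pred.
Proof.
by move=> /greatest_predP[f rf]; apply/greatest_predP; exists f; apply: acts_asJ.
Qed.

Definition greatest_sub := NormalSubgroup greatest_closed greatest_normal.

Definition greatest_fun (r : Gam) : kH :=
  if pselect (exists f, acts_as rho r f) is left e then projT1 (cid e) else 1.

Lemma greatest_funP r : r \in greatest_sub -> acts_as rho r (greatest_fun r).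
Proof.
by move/asboolP => e; rewrite /greatest_fun; case: pselect => // {}e; case: cid.
Qed.

Lemma greatest_funE r f : acts_as rho r f -> greatest_fun r = f.
Proof.
by move=> rf; apply: acts_as_inj (rf); apply: greatest_funP; apply/asboolP; exists f.
Qed.

Fact greatest_proof : quotient_data act [set: H]%G greatest_sub greatest_fun.
Proof.
split=> [r h rN _|r h rN _|r s rN sN h _|r rN l h _ _|r h rN _ s].
- apply/greatest_predP; rewrite -[h]invgK.
  by eexists; apply: acts_as_act (greatest_funP rN).
- by have [_ ->] := greatest_funP rN.
- by rewrite (greatest_funE (acts_asM (greatest_funP rN) (greatest_funP sN))) ffunE.
- rewrite (greatest_funE (acts_as_act l (greatest_funP rN))) !ffunE [RHS]mulrC.
  by symmetry; apply: mulVKf; have [_ ->] := greatest_funP rN.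
- by rewrite (greatest_funE (acts_asJ s (greatest_funP rN))).
Qed.

Definition greatest_datum : quotDatum k act := QuotDatum greatest_proof.

Lemma greatest_datum_compatible : qd_compatible rho greatest_datum.
Proof. by move=> r /greatest_funP; apply: acts_as_eq. Qed.

Lemma greatest_datum_max d : qd_compatible rho d -> qd_le d greatest_datum.
Proof.
move=> dc; split=> r rN; have rf := acts_as_datum dc rN.
  by apply/greatest_predP; exists (qd_fun d r).
exact: greatest_funE.
Qed.

End GreatestDatum.

(** * The Hopf algebra quotient attached to a datum *)

Section BasisExtension.
Variable k : fieldType.

(** Spanning, in the form in which it is used: linear maps out of [A] are
determined by their values on the family. *)
Definition spans (A : lmodType k) (I : Type) (e : I -> A) : Prop :=
  forall (V : lmodType k) (f g : A -> V), linear f -> linear g ->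
    (forall i, f (e i) = g (e i)) -> f =1 g.

Lemma mul_linearl (A : algType k) (b : A) : linear (fun a => a * b).
Proof. by move=> c x y; rewrite mulrDl -scalerAl. Qed.

Lemma mul_linearr (A : algType k) (a : A) : linear (fun b => a * b).
Proof. by move=> c x y; rewrite mulrDr -scalerAr. Qed.

Lemma spans_morphM (A B : algType k) (I : Type) (e : I -> A) (F : A -> B) :
  spans e -> linear F ->
  (forall i i', F (e i * e i') = F (e i) * F (e i')) ->
  {morph F : x y / x * y}.
Proof.
move=> se Flin FM x y.
apply: (se B (fun x => F (x * y)) (fun x => F x * F y)) => [||i].
- exact: (linear_comp_fun Flin (@mul_linearl A y)).
- exact: (linear_comp_fun (@mul_linearl B (F y)) Flin).
apply: (se B (fun y => F (e i * y)) (fun y => F (e i) * F y)) => [||i'].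
- exact: (linear_comp_fun Flin (@mul_linearr A (e i))).
- exact: (linear_comp_fun (@mul_linearr B (F (e i))) Flin).
exact: FM.
Qed.

Lemma smash_spans (H : finGroupType) (Gam : groupType) (act : autAction H Gam) :
  spans (fun p : Gam * H => smash_elt act p.1 (dirac k p.2)).
Proof.
move=> V f g fl gl fg; apply: malg_ext => // -[r h].
by rewrite -sharp_dirac; apply: (fg (r, h)).
Qed.

Lemma crossed_spans (H : finGroupType) (Gam : groupType)
    (act : autAction H Gam) (d : quotDatum k act) (j : quotSection (qd_sub d)) :
  spans (fun p : quotGroup (qd_sub d) * H => crossed_elt j p.1 (dirac k p.2)).
Proof.
move=> V f g fl gl fg; apply: malg_ext => // -[r h].
by rewrite -sharp_dirac; apply: (fg (r, h)).
Qed.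

End BasisExtension.

Arguments smash_spans {k H Gam} act [V f g].
Arguments crossed_spans {k H Gam act d} j [V f g].

Section CrossedProjection.
Variables (k : fieldType) (H : finGroupType) (Gam : groupType).
Variables (act : autAction H Gam) (d : quotDatum k act).
Variables (j : quotSection (qd_sub d)).
Local Notation kH := (funAlg k H).
Local Notation A := (smash k act).
Local Notation N := (qd_sub d).
Local Notation Φ := (qd_fun d).
Local Notation C := (crossed j).
Local Notation δ := (@dirac k H).
Local Notation u := (@canproj Gam N).
Local Notation "r # f" := (smash_elt act r f) (at level 37).
Local Notation "x ## f" := (crossed_elt j x f) (at level 37).

Lemma crossed_elt_linear x : linear (crossed_elt j x : kH -> C).
Proof. exact: sharp_linear. Qed.

(** Both sides are bilinear in [f] and [g], so it is enough to treat Dirac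
functions. *)
Lemma crossed_elt_mul x y f g :
  (x ## f) * (y ## g) = (x * y)%g ## (f * g * Φ (j x * j y * (j (x * y)%g)^-1)%g).
Proof.
have lin z := crossed_elt_linear z.
set c := Φ _.
pose m (f g : kH) : kH := f * g * c.
have ml g' : linear (m^~ g').
  exact: (linear_comp_fun (@mul_linearl _ _ c) (@mul_linearl _ _ g')).
have mr f' : linear (m f').
  exact: (linear_comp_fun (@mul_linearl _ _ c) (@mul_linearr _ _ f')).
rewrite -/(m f g) [f]funAlg_span (linear_sumZ _ _ _ (lin x)) (linear_sumZ _ _ _ (ml _)).
rewrite (linear_sumZ _ _ _ (lin _)) (linear_sumZ _ _ _ (@mul_linearl _ C _)).
apply: eq_bigr => h _; congr (_ *: _).
rewrite [g]funAlg_span (linear_sumZ _ _ _ (lin y)) (linear_sumZ _ _ _ (mr _)).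
rewrite (linear_sumZ _ _ _ (lin _)) (linear_sumZ _ _ _ (@mul_linearr _ C _)).
apply: eq_bigr => l _; congr (_ *: _).
rewrite -[x](qsecK j) -[y](qsecK j) crossed_eltM !qsecK canprojM !qsecK.
by [].
Qed.

Definition crossed_proj : A -> C :=
  mlin (fun p => u p.1 ## (δ p.2 * Φ (p.1 * (j (u p.1))^-1)%g)).

Fact crossed_proj_linear : linear crossed_proj.
Proof. exact: mlin_is_linear. Qed.

Lemma crossed_projE r f :
  crossed_proj (r # f) = u r ## (f * Φ (r * (j (u r))^-1)%g).
Proof.
have rl : linear (smash_elt act r : kH -> A) by apply: smash_elt_linear.
rewrite [f]funAlg_span (linear_sumZ _ _ _ rl) (linear_sumZ _ _ _ crossed_proj_linear).
rewrite (linear_sumZ _ _ _ (@mul_linearl _ kH _)).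
rewrite (linear_sumZ _ _ _ (crossed_elt_linear _)).
apply: eq_bigr => h _; congr (_ *: _).
by rewrite /smash_elt sharp_dirac; apply: mlinU.
Qed.

Lemma mem_qsec_quot r : (r * (j (u r))^-1)%g \in N.
Proof. by rewrite -canproj_eq qsecK. Qed.

Lemma mem_qsec_mul x y : (j x * j y * (j (x * y)%g)^-1)%g \in N.
Proof. by rewrite -canproj_eq canprojM !qsecK. Qed.

Fact crossed_proj_monoid : GRing.monoid_morphism crossed_proj.
Proof.
split.
  rewrite -[1]/(1%g # 1) crossed_projE mul1r canproj1 qsec1 mulgV qd_fun1.
  by [].
apply: (spans_morphM (@smash_spans k H Gam act) crossed_proj_linear) => -[r h] [s l] /=.
rewrite smash_eltM !crossed_projE crossed_elt_mul canprojM; congr (_ ## _).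
set x := u r; set y := u s.
set a := (r * (j x)^-1)%g; set b := (s * (j y)^-1)%g.
(* The defect of [j] at [r * s] is the product of the defects at [r] and at [s],
   the latter conjugated, and of the element of [N] whose image under [Φ] twists
   the product of the crossed algebra. *)
have -> : (r * s * (j (x * y)%g)^-1 =
    a * (j x * b * (j x)^-1) * (j x * j y * (j (x * y)%g)^-1))%g.
  by rewrite /a /b !mulgA !mulgVK.
have aN : a \in N by apply: mem_qsec_quot.
have bN : b \in N by apply: mem_qsec_quot.
have bN' := nsg_normal (j x) bN.
rewrite (qd_funM (nsgM aN bN') (mem_qsec_mul x y)) (qd_funM aN bN') qd_funJ //.
by rewrite mulrA (mulrACA (δ h)).
Qed.

HB.instance Definition _ := GRing.isLinear.Build k A C _
  crossed_proj crossed_proj_linear.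
HB.instance Definition _ := GRing.isMonoidMorphism.Build A C
  crossed_proj crossed_proj_monoid.

Lemma crossed_proj_hopf : hopf_map crossed_proj.
Proof.
have tl : linear (tmap crossed_proj crossed_proj).
  by apply: tmap_linear; apply: crossed_proj_linear.
have pl := crossed_proj_linear.
have Cl : linear (comul : C -> _) by apply: comul_linear.
have Al : linear (comul : A -> _) by apply: comul_linear.
split.
  apply: (smash_spans act (linear_comp_fun Cl pl) (linear_comp_fun tl Al)).
  case=> r h /=.
  rewrite crossed_projE diracM (linearZf _ _ (crossed_elt_linear _)) (linearZf _ _ Cl).
  rewrite crossed_comulE smash_comulE (linear_sumf _ _ tl) scaler_sumr.
  rewrite [LHS](reindex_inj invg_inj) /=; apply: eq_bigr => l _.
  rewrite tmap_pure // !crossed_projE invgK !diracM.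
  rewrite !(linearZf _ _ (crossed_elt_linear _)).
  apply: tpure_scale_eq.
  set a := (r * _)%g; set b := (_ * (j _)^-1)%g; set c := (_ * (j _)^-1)%g.
  have aN : a \in N by apply: mem_qsec_quot.
  have cN : c \in N by apply: mem_qsec_quot.
  (* [a] and [c] are the defects of [j] at [r] and at [act l^-1 r]; after
     translating [a] by [l^-1] they differ by the element [b] whose image under
     [Φ] twists the coproduct. *)
  have cE : c = (act l^-1%g a * b)%g.
    by rewrite /c /a /b aut_actMr aut_actV mulgA mulgVK.
  have aN' : act l^-1%g a \in N by apply: qd_stable.
  have bN : b \in N.
    have -> : b = ((act l^-1%g a)^-1 * c)%g by rewrite cE mulKg.
    exact: nsgM (nsgV aN') cN.
  rewrite cE qd_funM // ffunE -{1}(mulKVg l h) qd_fun_cocycle //.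
  by rewrite mulrAC mulrC.
have ce : linear (counit : C -> k^o) by apply: counit_scalar.
have ae : linear (counit : A -> k^o) by apply: counit_scalar.
apply: (smash_spans act (linear_comp_fun ce pl) ae).
case=> r h /=.
rewrite crossed_projE diracM (linearZf _ _ (crossed_elt_linear _)) (linearZf _ _ ce).
rewrite crossed_counitE smash_counitE; case: eqVneq => [->|_]; last exact: mulr0.
by rewrite qd_fun_at1 ?mem_qsec_quot //; apply: mulr1.
Qed.

(** The quotient map satisfies, for its own datum, the relations that define
compatibility. *)
Lemma crossed_proj_compat n :
  n \in N -> crossed_proj (n # 1) = crossed_proj (1%g # Φ n).
Proof.
rewrite (memN_proj d) => /eqP nN.
by rewrite !crossed_projE nN canproj1 qsec1 invg1 !mulg1 mul1r qd_fun1 mulr1.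
Qed.

Lemma crossed_proj_sec x f : crossed_proj (j x # f) = x ## f.
Proof. by rewrite crossed_projE qsecK mulgV qd_fun1 mulr1. Qed.

Lemma crossed_proj_surj y : exists x, crossed_proj x = y.
Proof.
pose s : C -> A := mlin (fun p => j p.1 # δ p.2).
have sl : linear s by apply: mlin_is_linear.
exists (s y); move: y.
apply: (crossed_spans j (linear_comp_fun crossed_proj_linear sl) (@idfun_linear _ C)).
case=> x h /=.
have -> : s (x ## δ h) = j x # δ h by rewrite /crossed_elt sharp_dirac; apply: mlinU.
exact: crossed_proj_sec.
Qed.

Section Descent.
Variables (R : algType k) (rho : {lrmorphism A -> R}).
Hypothesis d_compat : qd_compatible rho d.

Definition crossed_desc : C -> R := mlin (fun p => rho (j p.1 # δ p.2)).

Fact crossed_desc_linear : linear crossed_desc.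
Proof. exact: mlin_is_linear. Qed.

Lemma compat_mul n r f : n \in N -> rho (r # (f * Φ n)) = rho ((n * r)%g # f).
Proof.
move=> nN; have -> : r # (f * Φ n) = (1%g # Φ n) * (r # f) :> A.
  by rewrite smash_eltM mul1g mulrC.
rewrite [LHS]rmorphM -[X in X * _](d_compat nN) -[LHS]rmorphM.
by rewrite smash_eltM mul1r.
Qed.

Lemma crossed_descE x f : crossed_desc (x ## f) = rho (j x # f).
Proof.
have rl : linear (smash_elt act (j x) : kH -> A) by apply: smash_elt_linear.
have rhol : linear rho by apply: linearP.
rewrite [f]funAlg_span (linear_sumZ _ _ _ (crossed_elt_linear _)).
rewrite (linear_sumZ _ _ _ crossed_desc_linear) (linear_sumZ _ _ _ rl).
rewrite (linear_sumZ _ _ _ rhol); apply: eq_bigr => h _; congr (_ *: _).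
by rewrite /crossed_elt sharp_dirac; apply: mlinU.
Qed.

Lemma crossed_descK a : crossed_desc (crossed_proj a) = rho a.
Proof.
have rhol : linear rho by apply: linearP.
move: a; apply: (smash_spans act
  (linear_comp_fun crossed_desc_linear crossed_proj_linear) rhol).
case=> r h /=; rewrite [X in crossed_desc X]crossed_projE [LHS]crossed_descE.
by rewrite [LHS]compat_mul; [rewrite mulgVK|apply: mem_qsec_quot].
Qed.

Fact crossed_desc_monoid : GRing.monoid_morphism crossed_desc.
Proof.
split=> [|x y].
  by rewrite -[1](rmorph1 crossed_proj) crossed_descK rmorph1.
have [a <-] := crossed_proj_surj x; have [b <-] := crossed_proj_surj y.
transitivity (rho (a * b)).
  by rewrite -[RHS]crossed_descK; congr (crossed_desc _); rewrite [RHS]rmorphM.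
by rewrite [LHS]rmorphM -[X in X * _]crossed_descK -[X in _ * X]crossed_descK.
Qed.

Lemma crossed_datum_factorization :
  exists (q : {lrmorphism A -> C}) (rho' : {lrmorphism C -> R}),
    datum_factorization rho q rho'.
Proof.
pose rho' : {lrmorphism C -> R} := HB.pack crossed_desc
  (GRing.isLinear.Build k C R _ crossed_desc crossed_desc_linear)
  (GRing.isMonoidMorphism.Build C R crossed_desc crossed_desc_monoid).
exists crossed_proj, rho'; split=> [|r h|r h] /=.
- split; [exact: crossed_proj_hopf|exact: crossed_proj_surj|].
  by move=> a; symmetry; apply: crossed_descK.
- exact: crossed_projE.
- exact: crossed_descE.
Qed.

End Descent.
End CrossedProjection.

(** * Kernels of Hopf algebra maps out of the smash coproduct *)

(** The family [e r h] stands for the images of the basis elements in a Hopf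
algebra quotient, and [D l] for the coproduct of the quotient followed by the
projection of the first factor to its component at [l]. *)
Section SlicedFamily.
Variables (k : fieldType) (H : finGroupType) (Gam : groupType).
Variables (act : autAction H Gam) (V : lmodType k).
Variables (e : Gam -> H -> V) (D : H -> V -> tensor V V).
Hypothesis D_linear : forall l, linear (D l).
Hypothesis DE : forall l r h,
  D l (e r h) = e r l ⊗ e (act l^-1%g r) (l^-1 * h)%g.

(** [D l] sends [e r 1] and [e 1 1] to pure tensors, whose first factors are then
proportional; this defines [f].  Applying [D l] to the relation
[e r (l * h) = f (l * h) *: e 1 (l * h)] gives the cocycle identity. *)
Lemma sliced_cocycle r : (forall h, e 1%g h != 0) -> e r 1%g = e 1%g 1%g ->
  exists f : H -> k, [/\ f 1%g = 1, forall h, f h != 0 &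
    forall l h, f l *: e (act l^-1%g r) h = f (l * h)%g *: e 1%g h].
Proof.
move=> e0 r1.
have prop l : exists c, c != 0 /\ e r l = c *: e 1%g l.
  have := DE l 1%g 1%g; rewrite -r1 DE aut_act1g => eq1.
  have [c c0 cE] := tpure_proportional eq1 (e0 _) (e0 _).
  by exists c.
have [f fP] := choice prop; have f0 h := (fP h).1; have fE h := (fP h).2.
exists f; split=> // [|l h].
  have /eqP := fE 1%g; rewrite r1 -[X in X == _]scale1r -subr_eq0 -scalerBl.
  by rewrite scaler_eq0 (negPf (e0 _)) orbF subr_eq0 => /eqP.
have := DE l r (l * h)%g.
rewrite fE (linearZf _ _ (D_linear l)) DE aut_act1g !mulKg fE.
rewrite -(linearZf _ _ (tpure_linearr _)) (linearZf _ _ (tpure_linearl _)).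
rewrite -(linearZf _ _ (tpure_linearr _)) => /eqP.
rewrite -subr_eq0 -scaleN1r addrC -(tpure_linearr (e 1%g l)) => /eqP/tpure_eq0.
by move=> /(_ (e0 l))/eqP; rewrite scaleN1r addrC subr_eq0 => /eqP.
Qed.

(** [D 1] sends [e r 1] to [e r 1 ⊗ e r 1] and [e r h] to [e r 1 ⊗ e r h]: the
relation becomes one between group-like elements with the [e r h] as
coefficients, and the coefficient of each group-like element vanishes. *)
Lemma sliced_fiber h t (s : seq (k * Gam)) : (forall r, e r 1%g != 0) ->
  \sum_(p <- s) p.1 *: e p.2 h = 0 ->
  \sum_(p <- s | e p.2 1%g == e t 1%g) p.1 *: e p.2 h = 0.
Proof.
move=> e0 s0; pose key (p : k * Gam) := e p.2 1%g.
pose y g := \sum_(p <- s | key p == g) p.1 *: e p.2 h.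
have y0 : {in undup (map key s), forall g, y g = 0}.
  apply: (grouplike_tensor_free (D := D 1%g)) => [//||g|].
  - exact: undup_uniq.
  - rewrite mem_undup => /mapP[p _ ->]; split; first exact: e0.
    by rewrite DE invg1 aut_act1 mulg1.
  transitivity (D 1%g 0); last exact: (linear0f (D_linear _)).
  rewrite -[in RHS]s0 (linear_sumZ _ _ _ (D_linear _)) [RHS](sum_fibers _ key).
  apply: eq_bigr => g _; rewrite tpure_sumr.
  apply: eq_bigr => p /eqP <-.
  by rewrite (linearZf _ _ (tpure_linearr _)) DE invg1 aut_act1 mul1g.
have [/y0 //|tT] := boolP (e t 1%g \in undup (map key s)).
rewrite big_seq_cond big_pred0 // => p; apply/negP => /andP[ps /eqP pt].
by case/negP: tT; rewrite mem_undup -pt; apply: (map_f key ps).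
Qed.

End SlicedFamily.

Section HopfQuotient.
Variables (k : fieldType) (H : finGroupType) (Gam : groupType).
Variables (act : autAction H Gam).
Local Notation kH := (funAlg k H).
Local Notation A := (smash k act).
Local Notation δ := (@dirac k H).
Local Notation "r # f" := (smash_elt act r f) (at level 37).

Variables (L : hopfAlgType k) (q : {lrmorphism A -> L}).
Hypothesis q_hopf : hopf_map q.
Local Notation e r h := (q (r # δ h)).

Lemma image_eltM r s h : e r h * e s h = e (r * s)%g h.
Proof.
by rewrite -[LHS]rmorphM smash_eltM diracM diracE eqxx scale1r.
Qed.

Lemma image_elt_orth r h l : l != h -> e r h * e 1%g l = 0.
Proof.
move=> lh; rewrite -[LHS]rmorphM smash_eltM diracM diracE eq_sym (negPf lh).
by rewrite scale0r (linear0f (@smash_elt_linear _ _ _ act _)) [LHS]linear0.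
Qed.

(** As the images of the Dirac functions are orthogonal idempotents, multiplying
the first factor by one of them selects one term of the coproduct. *)
Definition coslice (l : H) (x : L) : tensor L L :=
  tmap (fun y => y * e 1%g l) idfun (comul x).

Lemma coslice_linear l : linear (coslice l).
Proof.
apply: linear_comp_fun; last exact: comul_linear.
exact: (tmap_linear (@mul_linearl _ L _) (@idfun_linear _ L)).
Qed.

Lemma cosliceE l r h : coslice l (e r h) = e r l ⊗ e (act l^-1%g r) (l^-1 * h)%g.
Proof.
have ql : linear q by apply: linearP.
have mlin := @mul_linearl _ L (e 1%g l).
have tl := tmap_linear mlin (@idfun_linear _ L).
have tq := tmap_linear ql ql.
rewrite /coslice q_hopf.1 smash_comulE (linear_sumf _ _ tq) (linear_sumf _ _ tl).
rewrite (bigD1 l) //= [X in _ + X]big1 ?addr0.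
  rewrite [X in tmap _ _ X]tmap_pure // [LHS]tmap_pure //.
  by rewrite image_eltM mulg1.
move=> m ml; rewrite [X in tmap _ _ X]tmap_pure // [LHS]tmap_pure //.
by rewrite image_elt_orth 1?eq_sym // (linear0f (tpure_linearl _)).
Qed.

Section Independent.
Hypothesis q_dirac : forall h, e 1%g h != 0.

Lemma image_elt_neq0 r h : e r h != 0.
Proof.
apply: contraNneq (q_dirac h) => z; apply/eqP.
by rewrite -(mulgV r) -[LHS]image_eltM [X in X * _]z mul0r.
Qed.

Lemma image_acts_as r : e r 1%g = e 1%g 1%g -> exists f, acts_as q r f.
Proof.
move=> r1; have [f [f1 f0 fE]] := sliced_cocycle coslice_linear cosliceE q_dirac r1.
have qE s (g : kH) : q (s # g) = \sum_h g h *: e s h.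
  rewrite {1}[g]funAlg_span (linear_sumZ _ _ _ (@smash_elt_linear _ _ _ act _)).
  by rewrite (linear_sumZ _ _ _ (linearP q)).
exists [ffun h => f h]; split=> [|h|l]; [by rewrite ffunE f1|by rewrite ffunE f0|].
rewrite !qE scaler_sumr; apply: eq_bigr => h _.
by rewrite !ffunE scale1r fE.
Qed.

(** Within a fibre of [r |-> e r 1], the elements [r # δ h] have proportional
images, under [q] and under [psi], with the same coefficients: if
[e r 1 = e t 1] then [r * t^-1] acts as some [f], and [f h] is the coefficient
relating [r] to [t].  So the partial relation over a fibre, which holds for [q]
by [sliced_fiber], is one equation between scalars that also serves [psi]. *)
Lemma kernel_contained (B : algType k) (psi : {lrmorphism A -> B}) :
  (forall r f, acts_as q r f -> psi (r # 1) = psi (1%g # f)) ->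
  forall a, q a = 0 -> psi a = 0.
Proof.
move=> psi_acts.
have ql : linear q by apply: linearP.
have psil : linear psi by apply: linearP.
have collinear r t h : e r 1%g = e t 1%g ->
    exists c, e r h = c *: e t h /\ psi (r # δ h) = c *: psi (t # δ h).
  move=> rt; have [|f af] := @image_acts_as (r * t^-1)%g.
    by rewrite -[LHS]image_eltM [X in X * _]rt [LHS]image_eltM mulgV.
  have split_elt g : (1%g # g) * (t # δ h) = g h *: (t # δ h) :> A.
    rewrite smash_eltM mul1g [g * _]mulrC diracM.
    by rewrite (linearZf _ _ (@smash_elt_linear _ _ _ act _)).
  have rE : r # δ h = ((r * t^-1)%g # 1) * (t # δ h) :> A.
    by rewrite smash_eltM mul1r mulgVK.
  exists (f h); rewrite rE; split.
    rewrite [LHS]rmorphM [X in X * _](acts_as_eq af) -[LHS]rmorphM split_elt.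
    exact: linearZ.
  rewrite [LHS]rmorphM [X in X * _](psi_acts _ _ af) -[LHS]rmorphM split_elt.
  exact: linearZ.
have level h (s : seq (k * Gam)) :
    \sum_(p <- s) p.1 *: e p.2 h = 0 -> \sum_(p <- s) p.1 *: psi (p.2 # δ h) = 0.
  move=> s0.
  rewrite (sum_fibers _ (fun p => e p.2 1%g)) big_seq big1 // => g.
  rewrite mem_undup => /mapP[[c0 t] _ ->] {g} /=.
  have := sliced_fiber coslice_linear cosliceE t (image_elt_neq0^~ 1%g) s0.
  have prop r : exists c : k, e r 1%g = e t 1%g ->
      e r h = c *: e t h /\ psi (r # δ h) = c *: psi (t # δ h).
    have [/(@collinear _ _ h)[c cE]|nE] := pselect (e r 1%g = e t 1%g).
      by exists c.
    by exists 0 => /nE.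
  have [c cP] := choice prop.
  have -> : \sum_(p <- s | e p.2 1%g == e t 1%g) p.1 *: e p.2 h =
      (\sum_(p <- s | e p.2 1%g == e t 1%g) p.1 * c p.2) *: e t h.
    rewrite scaler_suml; apply: eq_bigr => p /eqP/cP[-> _].
    exact: scalerA.
  have -> : \sum_(p <- s | e p.2 1%g == e t 1%g) p.1 *: psi (p.2 # δ h) =
      (\sum_(p <- s | e p.2 1%g == e t 1%g) p.1 * c p.2) *: psi (t # δ h).
    rewrite scaler_suml; apply: eq_bigr => p /eqP/cP[_ ->].
    exact: scalerA.
  move/eqP; rewrite scaler_eq0 (negPf (image_elt_neq0 _ _)) orbF => /eqP ->.
  exact: scale0r.
have slice (a : A) h : exists s : seq (k * Gam),
    a * (1%g # δ h) = \sum_(p <- s) p.1 *: (p.2 # δ h).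
  rewrite {1}[a]malg_span.
  exists [seq (a@_p * δ p.2 h, p.1) | p <- msupp a]; rewrite big_map.
  rewrite (linear_sumZ _ _ _ (@mul_linearl _ A _)); apply: eq_bigr => -[r l] _ /=.
  rewrite -sharp_dirac [X in a@_ _ *: X](@smash_elt_dirac _ _ _ act r (δ l) h).
  exact: scalerA.
move=> a a0.
have aE : a = \sum_h a * (1%g # δ h).
  rewrite -mulr_sumr -(linear_sumf _ _ (@smash_elt_linear _ _ _ act _)) -funAlg1E.
  by rewrite [RHS]mulr1.
rewrite aE (linear_sumf _ _ psil) big1 // => h _; have [s sE] := slice a h.
rewrite sE (linear_sumZ _ _ _ psil); apply: level.
rewrite -(linear_sumZ _ _ _ ql) -sE [LHS]rmorphM.
by rewrite [X in X * _]a0 mul0r.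
Qed.

End Independent.

(** Where [e 1 (h * l)] vanishes so does [e 1 h ⊗ e 1 l], hence the [h] with
[e 1 h] nonzero form a subgroup, and [rho] vanishes on the Dirac functions
outside of it. *)
Lemma image_dirac_neq0 (R : algType k) (rho : {lrmorphism A -> R})
    (phi : {lrmorphism L -> R}) :
  inner_faithful (rho \o funAlg_incl act) -> rho =1 phi \o q ->
  forall h, e 1%g h != 0.
Proof.
move=> inner rhoq.
have gG : group_set [set h | e 1%g h != 0].
  apply/group_setP; split=> [|h l]; rewrite !inE.
    apply/eqP => z; have := q_hopf.2 (1%g # δ 1%g).
    rewrite smash_counitE eqxx z (linear0f (counit_scalar : linear (counit : L -> k^o))).
    by move/eqP; rewrite eq_sym oner_eq0.
  move=> h0 l0; apply/eqP => z.
  have := cosliceE h 1%g (h * l)%g.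
  rewrite z (linear0f (coslice_linear _)) aut_act1g mulKg => /esym/tpure_eq0.
  by move=> /(_ h0)/eqP; rewrite (negPf l0).
move=> h; have := @support_inner_faithful _ _ (Group gG) _ _ inner _ h.
rewrite inE; apply=> l; rewrite inE negbK => /eqP z.
by rewrite [LHS]rhoq /= [X in phi X]z linear0.
Qed.

End HopfQuotient.

(** * Hopf images *)

Section Factorization.
Variable k : fieldType.

Lemma lrmorphism_factor (A B C : algType k) (p : {lrmorphism A -> B})
    (q : {lrmorphism A -> C}) :
  (forall y, exists x, p x = y) -> (forall a, p a = 0 -> q a = 0) ->
  exists f : {lrmorphism B -> C}, f \o p =1 q.
Proof.
move=> psurj ker; have [s sK] := choice psurj.
have qE a b : p a = p b -> q a = q b.
  move=> ab; apply/eqP; rewrite -subr_eq0 -linearB; apply/eqP/ker.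
  by rewrite linearB /= ab subrr.
pose f y := q (s y); have fE a : f (p a) = q a by apply: qE; rewrite sK.
have f_lin : linear f.
  by move=> c x y; rewrite -[x]sK -[y]sK -linearP !fE linearP.
have f_mon : GRing.monoid_morphism f.
  split=> [|x y]; first by rewrite -(rmorph1 p) fE rmorph1.
  by rewrite -[x]sK -[y]sK -rmorphM !fE rmorphM.
exists (HB.pack f (GRing.isLinear.Build k B C _ f f_lin)
  (GRing.isMonoidMorphism.Build B C f f_mon) : {lrmorphism B -> C}).
exact: fE.
Qed.

Lemma tmap_comp (U V W : lmodType k) (f : V -> W) (g : U -> V) t :
  linear f -> linear g -> tmap f f (tmap g g t) = tmap (f \o g) (f \o g) t.
Proof.
move=> fl gl; have fgl : linear (f \o g) by apply: linear_comp_fun.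
apply: (tensor_ext (g := fun t => tmap f f (tmap g g t))
  (h := tmap (f \o g) (f \o g))) => [||v w].
- exact: (linear_comp_fun (tmap_linear fl fl) (tmap_linear gl gl)).
- exact: tmap_linear.
- by rewrite !tmap_pure.
Qed.

Lemma hopf_map_factor (A B C : hopfAlgType k) (p : {lrmorphism A -> B})
    (q : {lrmorphism A -> C}) (f : {lrmorphism B -> C}) :
  hopf_map p -> (forall y, exists x, p x = y) -> hopf_map q ->
  f \o p =1 q -> hopf_map f.
Proof.
move=> [pD pe] psurj [qD qe] fp; split=> y; have [x <-] := psurj y.
  rewrite [f (p x)]fp qD pD tmap_comp; try exact: linearP.
  by have -> : f \o p = q by apply: funext.
by rewrite [f (p x)]fp qe pe.
Qed.

(** A factorization is final once its kernel is the largest, as its quotient map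
then factors through every other one; surjectivity does the rest. *)
Lemma hopf_image_of_kernel (A : hopfAlgType k) (R : algType k)
    (rho : {lrmorphism A -> R}) (C : hopfAlgType k)
    (q : {lrmorphism A -> C}) (rho' : {lrmorphism C -> R}) :
  hopf_factorization rho q rho' ->
  (forall (L : hopfAlgType k) (p : {lrmorphism A -> L})
      (phi : {lrmorphism L -> R}), hopf_factorization rho p phi ->
      forall a, p a = 0 -> q a = 0) ->
  hopf_image rho q rho'.
Proof.
move=> fq ker; split=> // L p phi fp.
have [hq _ rhoq] := fq; have [hp psurj rhop] := fp.
have [f fpq] := lrmorphism_factor psurj (ker _ _ _ fp).
exists f; split=> [|g [_ gpq _] y].
  split=> //; first exact: hopf_map_factor psurj hq fpq.
  by move=> y; have [x <-] := psurj y; rewrite -[RHS]rhop rhoq /= -fpq.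
by have [x <-] := psurj y; rewrite [g _]gpq -fpq.
Qed.

Lemma hopf_image_uniq (A : hopfAlgType k) (R : algType k)
    (rho : {lrmorphism A -> R}) (C L : hopfAlgType k)
    (q : {lrmorphism A -> C}) (rho' : {lrmorphism C -> R})
    (p : {lrmorphism A -> L}) (phi : {lrmorphism L -> R}) :
  hopf_image rho q rho' -> hopf_image rho p phi -> hopf_isomorphic C L.
Proof.
move=> [fq univq] [fp univp].
have [f [[_ fpq _] _]] := univq _ _ _ fp.
have [g [[hg gqp _] _]] := univp _ _ _ fq.
have [_ qsurj _] := fq; have [_ psurj _] := fp.
exists g; split=> //; exists f => y.
  by have [x <-] := qsurj y; rewrite [g _]gqp [f _]fpq.
by have [x <-] := psurj y; rewrite [f _]fpq [g _]gqp.
Qed.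

End Factorization.

Theorem proposition4p1 (k : fieldType) (H : finGroupType) (Gam : groupType)
    (act : autAction H Gam) (R : algType k)
    (rho : {lrmorphism smash k act -> R})
    (rho_inner : inner_faithful (rho \o funAlg_incl act)) :
  (* (a) *)
  [/\ forall d : quotDatum k act, qd_compatible rho d ->
        forall j : quotSection (qd_sub d),
        exists (q : {lrmorphism smash k act -> crossed j})
               (rho' : {lrmorphism crossed j -> R}),
          datum_factorization rho q rho',
  (* (b) *)
      exists d : quotDatum k act, qd_maximal rho d &
  (* (c) *)
      forall d : quotDatum k act, qd_maximal rho d ->
        forall (j : quotSection (qd_sub d))
               (q : {lrmorphism smash k act -> crossed j})
               (rho' : {lrmorphism crossed j -> R}),
          datum_factorization rho q rho' ->
          hopf_image rho q rho' /\
          forall (L : hopfAlgType k) (p : {lrmorphism smash k act -> L})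
                 (phi : {lrmorphism L -> R}),
            hopf_image rho p phi -> hopf_isomorphic (crossed j) L].
Proof.
split.
- by move=> d dc j; apply: crossed_datum_factorization.
- exists (greatest_datum rho_inner); split; first exact: greatest_datum_compatible.
  by move=> d dc _; apply: greatest_datum_max.
move=> d [dc dmax] j q rho' [fact qE _].
have [le_sub le_fun] : qd_le (greatest_datum rho_inner) d.
  by apply: dmax; [apply: greatest_datum_compatible|apply: greatest_datum_max].
suff im : hopf_image rho q rho' by split=> // L p phi; apply: hopf_image_uniq im.
apply: (hopf_image_of_kernel fact) => L p phi [hp psurj rhop].
have q_proj : q =1 crossed_proj j.
  apply: (smash_spans act (linearP q) (@crossed_proj_linear _ _ _ _ _ j)).
  by case=> r h; rewrite crossed_projE; apply: qE.
apply: (kernel_contained hp); first exact: (image_dirac_neq0 hp rho_inner rhop).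
move=> r f /(acts_as_comp rhop) rf.
have rN : r \in greatest_sub rho by apply/greatest_predP; exists f.
have fE : qd_fun d r = f by rewrite (le_fun r rN) [LHS](greatest_funE rho_inner rf).
rewrite [LHS]q_proj [RHS]q_proj -fE; apply: crossed_proj_compat.
exact: le_sub.
Qed.
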